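(* Let $P$ be a simplicial poset and $K$ a field. Let ${}^*\!D_S^\bullet$ be the normalized $\mathbb Z^n$-graded dualizing complex of $S$, and let $\Gamma^\bullet=\Gamma_{I_P}({}^*\!D_S^\bullet)$, so that $\Gamma^{-i}=\bigoplus_{x\in P,\ \operatorname{rank}x=i}E_x$ for all $i$. Then one can choose bases of $E_x$ for all $x\in P$ so that, with respect to these bases, the differential map $\partial^{-i}:\Gamma^{-i}\to\Gamma^{-i+1}$ is clean for all $i$.
   Context: Face ring. A simplicial poset is a finite poset $P$ with least element $\hat 0$ such that $\{y\in P\mid y\le x\}$ is isomorphic to a boolean algebra for every $x\in P$; $\operatorname{rank} x$ is the rank of this boolean algebra. Put $P^*=P\setminus\{\hat 0\}$. For $x_1,\dots,x_m\in P$, $[x_1\vee\cdots\vee x_m]$ is the set of minimal elements of $\{z\in P\mid z\ge x_1,\dots,x_m\}$. If $[x\vee y]\neq\emptyset$, then $\{z\mid z\le x,\ z\le y\}$ has a greatest element $x\wedge y$. Let $S=K[t_x\mid x\in P^*]$ be the polynomial ring over the field $K$, set $t_{\hat 0}=1$, and for $x,y\in P^*$ let $f_{x,y}=t_xt_y-t_{x\wedge y}\sum_{z\in[x\vee y]}t_z$ (interpreted as $t_xt_y$ if $[x\vee y]=\emptyset$). Let $I_P=(f_{x,y}\mid x,y\in P^* )\subset S$. Grading. Let $y_1,\dots,y_n$ be the rank 1 elements of $P$, $t_i:=t_{y_i}$, and $\operatorname{supp}(x)=\{i\mid y_i\le x\}$ for $x\in P$. $S$ is $\mathbb{Z}^n$-graded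 by $\deg t_x=\sum_{i\in\operatorname{supp}(x)}\mathbf{e}_i$, where $\mathbf e_i$ is the $i$-th coordinate vector. ${}^*\mathrm{Mod}\,S$ is the category of $\mathbb{Z}^n$-graded $S$-modules and degree-preserving $S$-homomorphisms. $M(\mathbf a)$ is the shift $M(\mathbf a)_{\mathbf b}=M_{\mathbf a+\mathbf b}$. The module $E_x$. For $x\in P$ let $\mathfrak{p}_x=(t_z\mid z\in P^*, z\not\le x)+I_P$, and $S_x=S/\mathfrak{p}_x\cong K[t_i\mid i\in\operatorname{supp}(x)]$; the surjection $\pi_x:S\to S_x$ sends $t_z$ to $\prod_{i\in\operatorname{supp}(z)}t_i$ if $z\le x$, and to $0$ otherwise. (The $\mathbb Z^n$-graded primes of $S$ containing $I_P$ are exactly the $\mathfrak p_x$, $x\in P$.) Let $P^*_{-x}=P^*\setminus\{y_i\mid i\in\operatorname{supp}(x)\}$ and $$E_x=K[t_i^{\pm1}\mid i\in\operatorname{supp}(x)]\otimes_K K[t_z^{-1}\mid z\in P^*_{-x}].$$ Here the first factor is an $S$-module via $\pi_x$; the second is Macaulay's inverse system, an $S$-module on which $t_i$ ($i\in\operatorname{supp}(x)$) acts as $0$ and $t_w$ ($w\in P^*_{-x}$) sends a monomial $\prod_z t_z^{-a_z}$ ($a_z\in\mathbb{N}$, with $0\in\mathbb N$) to the monomial with $a_w$ replaced by $a_w-1$ if $a_w>0$, and to $0$ if $a_w=0$. $S$ acts on $E_x$ by $t_z\cdot(u\otimes v)=\pi_x(t_z)u\otimes v+u\otimes t_zv$ for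 $z\in P^*$. $E_x$ is $\mathbb{Z}^n$-graded by $\deg(u\otimes v)=\deg u+\deg v$, with $\deg t_z^{-1}=-\deg t_z$. A monomial of $E_x$ is an element $\prod_{i}t_i^{a_i}\otimes\prod_z t_z^{-a_z}$ with $a_i\in\mathbb Z$, $a_z\in\mathbb N$; the monomials form the standard $K$-basis of $E_x$. $E_x$ is the injective envelope of $S/\mathfrak p_x$ in ${}^*\mathrm{Mod}\,S$. Dualizing complex. Let $N=\#P^*=\dim S$ and $\mathbf w=\sum_{x\in P^*}\deg t_x$. ${}^*\!D_S^\bullet$ is the minimal injective resolution of $S(-\mathbf w)$ in ${}^*\mathrm{Mod}\,S$, placed in cohomological degrees $-N,\dots,0$, so that $H^{-N}({}^*\!D_S^\bullet)\cong S(-\mathbf w)$ and the other cohomologies vanish. $\Gamma_{I_P}(M)=\{m\in M\mid I_P^km=0\text{ for some }k\}$. It is known that $\Gamma^{-i}$ is isomorphic in ${}^*\mathrm{Mod}\,S$ to $\bigoplus_{\operatorname{rank}x=i}E_x$; fix such identifications. Bases and cleanness. The total degree of a homogeneous element of $\mathbb{Z}^n$-degree $(a_1,\dots,a_n)$ is $\deg_{\mathbb Z}=\sum a_i$. For $m\in\mathbb N$, $E_x^{-m}$ is the $K$-span of the monomials $u\otimes v$ of $E_x$ with $\deg_{\mathbb Z}v=-m$. Let $\mathcal L(E_x)=\big[\bigoplus_{i\ge1}E_x^{-i}\big]_{\ge\mathbf 0}$, where $[\,\cdot\,]_{\ge\mathbf 0}$ is the sum of the components of $\mathbb Z^n$-degree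 $\mathbf a$ with all entries nonnegative. Choosing a basis of $E_x$ means choosing a degree-preserving $S$-module automorphism $\sigma_x$ of $E_x$ and using the images under $\sigma_x$ of the standard monomials in place of the monomials; accordingly the subspace $\mathcal L(E_x)$ taken with respect to this basis is the image under $\sigma_x$ of the one for the standard basis. For a direct sum $E=\bigoplus_xE_x^{l_x}$ with a fixed basis for each summand, $\mathcal L(E)=\bigoplus_x\mathcal L(E_x)^{l_x}$. A degree-preserving $S$-homomorphism $\psi:E\to F$ between such direct sums is clean if $\psi(\mathcal L(E))\subset\mathcal L(F)$. *)

(* Defs.v *)
From HB Require Import structures.
From mathcomp Require Import all_boot all_order all_algebra.
From mathcomp Require Import freeg mpoly.

Set Implicit Arguments.
Unset Strict Implicit.
Unset Printing Implicit Defensive.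

Import Order.TTheory GRing.Theory Num.Theory.
Local Open Scope ring_scope.

Definition boolean_below {d} {P : finBPOrderType d} (x : P) (n : nat) : Prop :=
  exists f : {y : P | (y <= x)%O} -> {set 'I_n},
    bijective f /\ forall y z, (val y <= val z)%O = (f y \subset f z).

(* [rank] is carried as data, but [boolean_rank] determines it since
   #|{set 'I_n}| = 2 ^ n. *)
Record simplicialPoset (d : Order.disp_t) := SimplicialPoset {
  poset_of :> finBPOrderType d;
  rank : poset_of -> nat;
  boolean_rank : forall x, boolean_below x (rank x)
}.

Section FaceRing.
Context {d : Order.disp_t} (P : simplicialPoset d) (K : fieldType).

Definition pstar : Type := {x : P | x != \bot%O}.
HB.instance Definition _ := Finite.on pstar.
HB.instance Definition _ := SubFinite.on pstar.

(* The rank 1 elements index the coordinates of Z^n. *)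
Definition vertex : Type := {y : P | rank y == 1%N}.
HB.instance Definition _ := Finite.on vertex.
HB.instance Definition _ := SubFinite.on vertex.

Definition supp (x : P) : {set vertex} := [set i : vertex | (val i <= x)%O].

Definition upper_bounds (x y : P) : {set P} :=
  [set z | (x <= z)%O && (y <= z)%O].

Definition joins (x y : P) : {set P} :=
  [set z in upper_bounds x y |
    [forall w in upper_bounds x y, (w <= z)%O ==> (w == z)]].

(* The default value \bot is never relevant: the meet exists whenever
   [joins x y] is nonempty, and otherwise it multiplies an empty sum. *)
Definition meet (x y : P) : P :=
  odflt \bot%O [pick m : P | [&& (m <= x)%O, (m <= y)%O &
    [forall w : P, ((w <= x)%O && (w <= y)%O) ==> (w <= m)%O]]].

Notation npstar := #|{: pstar}|.

Notation polyS := {mpoly K[npstar]}.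

Definition tvar (x : P) : polyS :=
  if insub x is Some x' then 'X_(@enum_rank pstar x') else 1.

Definition face_rel (x y : P) : polyS :=
  tvar x * tvar y - tvar (meet x y) * \sum_(z in joins x y) tvar z.

Definition ideal_gen (G : polyS -> Prop) (p : polyS) : Prop :=
  exists s : seq (polyS * polyS),
    (forall c, c \in s -> G c.2) /\ p = \sum_(c <- s) c.1 * c.2.

Definition face_ideal : polyS -> Prop :=
  ideal_gen (fun p => exists x y : pstar, p = face_rel (val x) (val y)).

Definition ideal_pow (I : polyS -> Prop) (k : nat) : polyS -> Prop :=
  ideal_gen (fun p => exists u : 'I_k -> polyS,
    (forall j, I (u j)) /\ p = \prod_(j < k) u j).

Notation zdeg := {ffun vertex -> int}.

Definition deg_t (x : P) : zdeg := [ffun i => (i \in supp x)%:R].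

Definition total_deg (a : zdeg) : int := \sum_i a i.

Definition nonneg_deg (a : zdeg) : bool := [forall i, 0 <= a i].

Definition deg_mnm (m : 'X_{1..npstar}) : zdeg :=
  \sum_(k < npstar) deg_t (val (enum_val k)) *+ m k.

Definition homog_poly (a : zdeg) (p : polyS) : Prop :=
  forall m, m \in msupp p -> deg_mnm m = a.

Record gradedModule := GradedModule {
  gmod :> lmodType polyS;
  homogeneous : zdeg -> gmod -> Prop;
  homog0 : forall a, homogeneous a 0;
  homogD : forall a u v, homogeneous a u -> homogeneous a v -> homogeneous a (u + v);
  homogZ : forall a b p u,
    homog_poly b p -> homogeneous a u -> homogeneous (b + a) (p *: u);
  homog_span : forall u, exists (s : seq zdeg) (f : zdeg -> gmod),
    (forall a, homogeneous a (f a)) /\ u = \sum_(a <- s) f a;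
  homog_free : forall (s : seq zdeg) (f : zdeg -> gmod), uniq s ->
    (forall a, homogeneous a (f a)) -> \sum_(a <- s) f a = 0 ->
    forall a, a \in s -> f a = 0
}.

Record ghom (M N : gradedModule) := GHom {
  ghom_fun :> {linear M -> N};
  ghomP : forall a u, homogeneous a u -> homogeneous a (ghom_fun u)
}.

Fact ghom_inj_homog (M N : gradedModule) (f : ghom M N) a u :
  injective f -> homogeneous a (f u) -> homogeneous a u.
Proof.
move=> finj hfu; have [s [g [hg uE]]] := homog_span u.
pose r := undup (a :: s); pose part b := \sum_(c <- s | c == b) g c.
have hpart b : homogeneous b (part b).
  by rewrite /part; elim/big_rec: _ => [|c v /eqP <- hv];
     [exact: homog0 | exact: homogD].
have ur : uniq r by apply: undup_uniq.
have ar : a \in r by rewrite mem_undup mem_head.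
have {}uE : u = \sum_(b <- r) part b.
  rewrite {1}uE (exchange_big_dep predT) //=; apply: eq_big_seq => c cs.
  under eq_bigl do rewrite eq_sym.
  rewrite -big_filter filter_pred1_uniq ?big_seq1 //.
  by rewrite mem_undup inE cs orbT.
pose h b := f (part b) - (if b == a then f u else 0).
have hh b : homogeneous b (h b).
  apply: homogD; first exact: ghomP.
  rewrite -scaleN1r -[b]add0r; apply: homogZ; last first.
    by rewrite add0r; case: eqP => [->|_] //; exact: homog0.
  move=> m; rewrite (perm_mem (msuppN _)) -mpolyX0 msuppX inE => /eqP->.
  by rewrite /deg_mnm big1 // => k _; rewrite mnm0E.
have h0 : \sum_(b <- r) h b = 0.
  rewrite big_split sumrN -linear_sum -uE -big_mkcond -big_filter.
  by rewrite filter_pred1_uniq // big_seq1; exact: subrr.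
suff -> : u = part a by [].
rewrite {1}uE (bigD1_seq a) //= big_seq_cond big1 ?addr0 // => b /andP[br ba].
have := homog_free ur hh h0 br; rewrite /h (negPf ba) subr0 => fb0.
by apply: finj; rewrite fb0 linear0.
Qed.

Record gaut (M : gradedModule) := GAut {
  gaut_hom :> ghom M M;
  gaut_bij : bijective gaut_hom
}.

Definition gsubmodule (M : gradedModule) (N : M -> Prop) : Prop :=
  [/\ N 0,
      forall (p : polyS) u v, N u -> N v -> N (p *: u + v) &
      forall u, N u -> exists (s : seq zdeg) (f : zdeg -> M),
        (forall a, homogeneous a (f a) /\ N (f a)) /\ u = \sum_(a <- s) f a].

Definition essential (M : gradedModule) (A : M -> Prop) : Prop :=
  forall N : M -> Prop, gsubmodule N -> (exists2 u, N u & u <> 0) ->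
  exists u, [/\ N u, A u & u <> 0].

Definition ginjective (E : gradedModule) : Prop :=
  forall (A B : gradedModule) (f : ghom A B) (g : ghom A E), injective f ->
  exists h : ghom B E, forall u, h (f u) = g u.

Definition Gamma (M : gradedModule) (u : M) : Prop :=
  exists k, forall p : polyS, ideal_pow face_ideal k p -> p *: u = 0.

Section Shift.
Context (M : gradedModule) (a : zdeg).

Definition shift_homog (b : zdeg) (u : M) : Prop := homogeneous (a + b) u.

Fact shift_homogZ b c p u :
  homog_poly c p -> shift_homog b u -> shift_homog (c + b) (p *: u).
Proof. by move=> hp hu; rewrite /shift_homog addrCA; exact: homogZ. Qed.

Fact shift_span u : exists (s : seq zdeg) (f : zdeg -> M),
  (forall b, shift_homog b (f b)) /\ u = \sum_(b <- s) f b.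
Proof.
have [s [f [hf ->]]] := homog_span u.
exists [seq b - a | b <- s], (fun b => f (a + b)); split=> [b|]; first exact: hf.
by rewrite big_map; apply: eq_bigr => b _; rewrite addrC subrK.
Qed.

Fact shift_free (s : seq zdeg) (f : zdeg -> M) : uniq s ->
  (forall b, shift_homog b (f b)) -> \sum_(b <- s) f b = 0 ->
  forall b, b \in s -> f b = 0.
Proof.
move=> us hf s0 b bs.
have h := @homog_free M [seq a + c | c <- s] (fun c => f (c - a)).
rewrite -[b](addKr a) [- a + _]addrC; apply: h (map_f _ bs).
- by rewrite map_inj_uniq //; exact: addrI.
- by move=> c; have := hf (c - a); rewrite /shift_homog addrC subrK.
- by rewrite big_map -[RHS]s0; apply: eq_bigr => c _; rewrite addrC addKr.
Qed.

Definition shift : gradedModule :=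
  @GradedModule M shift_homog
    (fun b => homog0 M (a + b))
    (fun b u v => @homogD M (a + b) u v)
    shift_homogZ shift_span shift_free.
End Shift.

Section RegularModule.

Fact homog_poly0 a : homog_poly a 0.
Proof. by move=> m; rewrite msupp0. Qed.

Fact homog_polyD a p q :
  homog_poly a p -> homog_poly a q -> homog_poly a (p + q).
Proof.
by move=> hp hq m /msuppD_le; rewrite mem_cat => /orP[/hp|/hq].
Qed.

Fact deg_mnmD m1 m2 : deg_mnm (m1 + m2)%MM = deg_mnm m1 + deg_mnm m2.
Proof.
by rewrite -big_split; apply: eq_bigr => k _; rewrite mnmDE mulrnDr.
Qed.

Fact homog_polyM a b p q :
  homog_poly b p -> homog_poly a q -> homog_poly (b + a) (p * q).
Proof.
move=> hp hq m /msuppM_le /allpairsP[[m1 m2] /= [/hp <- /hq <- ->]].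
exact: deg_mnmD.
Qed.

Definition poly_part (p : polyS) (a : zdeg) : polyS :=
  \sum_(m <- msupp p | deg_mnm m == a) p@_m *: 'X_[m].

Fact homog_poly_part p a : homog_poly a (poly_part p a).
Proof.
rewrite /poly_part; elim/big_rec: _ => [|m q /eqP dm hq]; first exact: homog_poly0.
apply: homog_polyD hq => m' /msuppZ_le.
by rewrite msuppX inE => /eqP->.
Qed.

Fact homog_poly_span (p : polyS) : exists (s : seq zdeg) (f : zdeg -> polyS),
  (forall a, homog_poly a (f a)) /\ p = \sum_(a <- s) f a.
Proof.
exists (undup [seq deg_mnm m | m <- msupp p]), (poly_part p); split.
  exact: homog_poly_part.
rewrite {1}[p]mpolyE /poly_part (exchange_big_dep predT) //=.
apply: eq_big_seq => m mp.
under eq_bigl do rewrite eq_sym.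
rewrite -big_filter filter_pred1_uniq ?undup_uniq ?mem_undup ?map_f //.
by rewrite big_seq1.
Qed.

Fact homog_poly_free (s : seq zdeg) (f : zdeg -> polyS) : uniq s ->
  (forall a, homog_poly a (f a)) -> \sum_(a <- s) f a = 0 ->
  forall a, a \in s -> f a = 0.
Proof.
move=> us hf s0 a as_; apply/mpolyP => m; rewrite mcoeff0.
case: (boolP (m \in msupp (f a))) => [mf|/memN_msupp_eq0 //].
have := congr1 (mcoeff m) s0; rewrite raddf_sum /= mcoeff0.
rewrite (bigD1_seq a) //= big1 ?addr0 // => b ba.
apply: memN_msupp_eq0; apply/negP => /(hf b) e.
by move: ba; rewrite -e (hf a m mf) eqxx.
Qed.

Definition regular_gm : gradedModule :=
  @GradedModule (polyS^o : lmodType polyS) homog_poly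
    homog_poly0 homog_polyD homog_polyM homog_poly_span homog_poly_free.
End RegularModule.

(* The K-space V on which the k-th variable of S acts as [T k]. *)
Section OperatorModule.
Context (V : lmodType K) (T : 'I_npstar -> {linear V -> V}).
Hypothesis TC : forall i j v, T i (T j v) = T j (T i v).

Definition op_mnm (m : 'X_{1..npstar}) (v : V) : V :=
  foldr (fun i w => iter (m i) (T i) w) v (enum 'I_npstar).

Definition op_scale (p : polyS) (v : V) : V :=
  \sum_(m <- msupp p) p@_m *: op_mnm m v.

Local Notation fold s m v :=
  (foldr (fun i w => iter ((m : 'X_{1..npstar}) i) (T i) w) v s).

Fact iter_opC i j k v : T j (iter k (T i) v) = iter k (T i) (T j v).
Proof. by elim: k => //= k IH; rewrite TC IH. Qed.

Fact op_foldC s m j v : T j (fold s m v) = fold s m (T j v).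
Proof. by elim: s => //= i s IH; rewrite iter_opC IH. Qed.

Fact op_foldC_iter s m j k v : iter k (T j) (fold s m v) = fold s m (iter k (T j) v).
Proof. by elim: k => //= k IH; rewrite IH op_foldC. Qed.

Fact op_mnm_linear m a u v :
  op_mnm m (a *: u + v) = a *: op_mnm m u + op_mnm m v.
Proof.
rewrite /op_mnm; elim: (enum _) => //= i s ->.
by elim: (m i) => //= k ->; rewrite linearP.
Qed.

HB.instance Definition _ m := GRing.isLinear.Build K V V *:%R (op_mnm m)
  (op_mnm_linear m).

Fact op_mnm0 v : op_mnm 0%MM v = v.
Proof. by rewrite /op_mnm; elim: (enum _) => //= i s ->; rewrite mnm0E. Qed.

Fact op_mnmD m1 m2 v : op_mnm (m1 + m2)%MM v = op_mnm m1 (op_mnm m2 v).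
Proof.
rewrite /op_mnm; elim: (enum _) => //= i s IH.
by rewrite mnmDE iterD IH op_foldC_iter.
Qed.

Fact op_scale_widen (p : polyS) r v : uniq r -> {subset msupp p <= r} ->
  op_scale p v = \sum_(m <- r) p@_m *: op_mnm m v.
Proof.
move=> ur sr; rewrite [RHS](bigID (mem (msupp p))) /= [X in _ + X]big1.
  rewrite addr0 -big_filter; apply: perm_big; apply: uniq_perm.
  - exact: msupp_uniq.
  - exact: filter_uniq.
  - by move=> m; rewrite mem_filter /=; case: (boolP (m \in msupp p)) => // /sr ->.
by move=> m /memN_msupp_eq0 ->; rewrite scale0r.
Qed.

Fact op_scaleDl v : {morph op_scale^~ v : p q / p + q}.
Proof.
move=> p q; pose r := undup (msupp p ++ msupp q).
have ur : uniq r by apply: undup_uniq.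
rewrite !(op_scale_widen v ur).
- by rewrite -big_split; apply: eq_bigr => m _; rewrite mcoeffD scalerDl.
- by move=> m mq; rewrite mem_undup mem_cat mq orbT.
- by move=> m mp; rewrite mem_undup mem_cat mp.
- by move=> m /msuppD_le; rewrite mem_undup.
Qed.

Fact op_scale0l v : op_scale 0 v = 0.
Proof. by rewrite /op_scale msupp0 big_nil. Qed.

Fact op_scaleZX c m v : op_scale (c *: 'X_[m]) v = c *: op_mnm m v.
Proof.
rewrite (@op_scale_widen _ [:: m]) ?big_seq1 //; last first.
  by move=> m' /msuppZ_le; rewrite msuppX.
by rewrite mcoeffZ mcoeffX eqxx mulr1.
Qed.

Fact op_scale_suml v I (r : seq I) (F : I -> polyS) :
  op_scale (\sum_(i <- r) F i) v = \sum_(i <- r) op_scale (F i) v.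
Proof.
elim: r => [|i r IH]; first by rewrite !big_nil op_scale0l.
by rewrite !big_cons op_scaleDl IH.
Qed.

Fact op_scale1 : left_id 1 op_scale.
Proof.
move=> v; rewrite -mpolyX0 -[X in op_scale X]scale1r op_scaleZX.
by rewrite op_mnm0 scale1r.
Qed.

Fact op_scaleDr : right_distributive op_scale +%R.
Proof.
move=> p u v; rewrite -big_split; apply: eq_bigr => m _.
by rewrite raddfD scalerDr.
Qed.

Fact op_scaleA p q v : op_scale p (op_scale q v) = op_scale (p * q) v.
Proof.
rewrite mpolyME op_scale_suml big_allpairs /=.
apply: eq_bigr => m1 _; rewrite linear_sum scaler_sumr.
apply: eq_bigr => m2 _ /=.
by rewrite op_scaleZX op_mnmD linearZ scalerA.
Qed.

Definition opmod of (forall i j v, T i (T j v) = T j (T i v)) : Type := V.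
HB.instance Definition _ := GRing.Zmodule.on (opmod TC).
HB.instance Definition _ := GRing.Zmodule_isLmodule.Build polyS (opmod TC)
  op_scaleA op_scale1 op_scaleDr (fun v => op_scaleDl v).
End OperatorModule.

Section Ex.
Context (x : P).

Definition lau_var : Type := {i : vertex | i \in supp x}.
HB.instance Definition _ := Finite.on lau_var.
HB.instance Definition _ := SubFinite.on lau_var.

Definition inv_var : Type :=
  {z : pstar | [forall i in supp x, val i != val z]}.
HB.instance Definition _ := Finite.on inv_var.
HB.instance Definition _ := SubFinite.on inv_var.

(* (a, b) stands for \prod_i t_i ^ (a i) (x) \prod_z t_z ^ (- b z). *)
Definition mon : Type := ({ffun lau_var -> int} * {ffun inv_var -> nat})%type.
HB.instance Definition _ := Choice.on mon.

Notation carrier := {freeg mon / K}.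

Definition lau_act (z : pstar) (k : mon) : carrier :=
  if (val z <= x)%O
  then << (k.1 + [ffun i => (val i \in supp (val z))%:R], k.2) >> else 0.

Definition inv_act (z : pstar) (k : mon) : carrier :=
  if insub z is Some w then
    if (0 < k.2 w)%N
    then << (k.1, [ffun w' => (k.2 w' - (w' == w))%N]) >> else 0
  else 0.

Definition E_op (z : pstar) (e : carrier) : carrier :=
  fglift (lau_act z) e + fglift (inv_act z) e.

Fact fglift_linear (f : mon -> carrier) a u v :
  fglift f (a *: u + v) = a *: fglift f u + fglift f v.
Proof.
have fD w1 w2 : fglift f (w1 + w2) = fglift f w1 + fglift f w2.
  have := lift_is_additive f w1 (- w2); rewrite opprK => ->.
  by have := lift_is_additive f 0 w2; rewrite sub0r => ->;
     rewrite -{1}[0]subr0 lift_is_additive subrr sub0r opprK.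
have f0 : fglift f 0 = 0.
  by rewrite -{1}[0]subr0 lift_is_additive subrr.
have fS (r : seq mon) (F : mon -> carrier) :
    fglift f (\sum_(k <- r) F k) = \sum_(k <- r) fglift f (F k).
  elim: r => [|k r IH]; first by rewrite !big_nil.
  by rewrite !big_cons fD IH.
rewrite fD; congr (_ + _).
rewrite -{2}[u]freeg_sumE !fS scaler_sumr; apply: eq_bigr => k _.
by rewrite !liftU scalerA.
Qed.

HB.instance Definition _ f := GRing.isLinear.Build K carrier carrier *:%R
  (fglift f) (fglift_linear f).

Fact E_op_linear z a u v : E_op z (a *: u + v) = a *: E_op z u + E_op z v.
Proof. by rewrite /E_op !linearP scalerDr addrACA. Qed.

HB.instance Definition _ z := GRing.isLinear.Build K carrier carrier *:%R
  (E_op z) (E_op_linear z).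

Fact E_op_U z k : E_op z << k >> = lau_act z k + inv_act z k.
Proof. by rewrite /E_op !liftU !scale1r. Qed.

Fact freeg_scaleU (c : K) (k : mon) : << c *g k >> = c *: << k >> :> carrier.
Proof.
by apply/eqP/freeg_eqP => k'; rewrite coeffZ !coeffU mul1r.
Qed.

Fact lau_actC z w k :
  fglift (lau_act z) (lau_act w k) = fglift (lau_act w) (lau_act z k).
Proof.
rewrite {2}/lau_act {3}/lau_act; case: ifP => wx; case: ifP => zx;
  rewrite ?linear0 // ?liftU ?scale1r /lau_act /= ?zx ?wx ?linear0 //.
by rewrite addrAC.
Qed.

Fact lau_invC z w k :
  fglift (lau_act z) (inv_act w k) = fglift (inv_act w) (lau_act z k).
Proof.
rewrite {1}/inv_act {2}/lau_act.
case: ifP => zx; last first.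
  rewrite linear0; case: insub => [w'|]; last by rewrite linear0.
  by case: ifP; rewrite ?linear0 // liftU scale1r /lau_act zx.
rewrite liftU scale1r /inv_act; case: insub => [w'|]; last by rewrite linear0.
by case: ifP; rewrite ?linear0 //= liftU scale1r /lau_act zx.
Qed.

Fact inv_actC z w k :
  fglift (inv_act z) (inv_act w k) = fglift (inv_act w) (inv_act z k).
Proof.
rewrite {2}/inv_act {3}/inv_act.
case ew: (insub w : option inv_var) => [w'|];
  case ez: (insub z : option inv_var) => [z'|]; rewrite ?linear0 //.
- have [eq_wz|nwz] := eqVneq w' z'.
    rewrite eq_wz; have -> // : w = z.
    by move: ew ez; rewrite eq_wz; do 2!case: insubP => // ? _ <- [->].
  have nzw : z' != w' by rewrite eq_sym.
  case: ifP => hw; case: ifP => hz; rewrite ?linear0 //=.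
  + rewrite !liftU !scale1r /inv_act ew ez /= !ffunE (negPf nwz) (negPf nzw).
    rewrite !subn0 hw hz; congr << (_, _) >>.
    by apply/ffunP => v; rewrite !ffunE subnAC.
  + by rewrite liftU scale1r /inv_act ez /= ffunE (negPf nzw) subn0 hz.
  + by rewrite liftU scale1r /inv_act ew /= ffunE (negPf nwz) subn0 hw.
- by case: ifP; rewrite ?linear0 //= liftU scale1r /inv_act ez.
- by case: ifP; rewrite ?linear0 //= liftU scale1r /inv_act ew.
Qed.

Fact E_opC z w e : E_op z (E_op w e) = E_op w (E_op z e).
Proof.
rewrite -[e]freeg_sumE !linear_sum; apply: eq_bigr => k _.
rewrite freeg_scaleU !linearZ /=; congr (_ *: _).
rewrite !E_op_U !linearD /= /E_op lau_actC inv_actC !lau_invC.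
by rewrite addrACA.
Qed.

Definition deg_lau (a : {ffun lau_var -> int}) : zdeg :=
  [ffun i => if insub i is Some j then a j else 0].

Definition deg_inv (b : {ffun inv_var -> nat}) : zdeg :=
  - \sum_(z : inv_var) deg_t (val (val z)) *+ b z.

Definition deg_mon (k : mon) : zdeg := deg_lau k.1 + deg_inv k.2.

Definition E_homog (a : zdeg) (e : carrier) : Prop :=
  forall k, k \in dom e -> deg_mon k = a.

Fact E_homog0 a : E_homog a 0.
Proof. by move=> k; rewrite dom0. Qed.

Fact E_homogD a u v : E_homog a u -> E_homog a v -> E_homog a (u + v).
Proof.
by move=> hu hv k /domD_subset; rewrite mem_cat => /orP[/hu|/hv].
Qed.

Fact E_homogS a c u : E_homog a u -> E_homog a (c *: u).
Proof. by move=> hu k /domZ_subset /hu. Qed.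

Fact E_homog_sum a I (r : seq I) (Q : pred I) (F : I -> carrier) :
  (forall i, Q i -> E_homog a (F i)) -> E_homog a (\sum_(i <- r | Q i) F i).
Proof.
by move=> hF; elim/big_rec: _ => [|i u Qi hu];
   [exact: E_homog0 | apply: E_homogD => //; exact: hF].
Qed.

Fact E_homogU k : E_homog (deg_mon k) << k >>.
Proof. by move=> k'; rewrite domU1 inE => /eqP->. Qed.

Fact lau_act_homog z k : E_homog (deg_t (val z) + deg_mon k) (lau_act z k).
Proof.
rewrite /lau_act; case: ifP => zx; last exact: E_homog0.
suff -> : deg_t (val z) + deg_mon k = deg_mon
    (k.1 + [ffun i => (val i \in supp (val z))%:R], k.2) by exact: E_homogU.
rewrite /deg_mon addrA; congr (_ + _).
apply/ffunP => i; rewrite !ffunE /=; case: insubP => [j _ <-|].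
  by rewrite !ffunE addrC.
rewrite !inE => ix; case: (boolP (val i <= val z)%O) => // iz.
by rewrite (le_trans iz zx) in ix.
Qed.

Fact inv_act_homog z k : E_homog (deg_t (val z) + deg_mon k) (inv_act z k).
Proof.
rewrite /inv_act; case: insubP => [w _ <-|_]; last exact: E_homog0.
case: ifP => kw; last exact: E_homog0.
suff -> : deg_t (val (val w)) + deg_mon k = deg_mon
    (k.1, [ffun w' => (k.2 w' - (w' == w))%N]) by exact: E_homogU.
rewrite /deg_mon addrCA; congr (_ + _); rewrite /deg_inv /=.
rewrite (bigD1 w) //= [X in _ = - X](bigD1 w) //= ffunE eqxx.
rewrite !opprD addrA; congr (_ + _).
  by case: (k.2 w) kw => // n _; rewrite subn1 mulrS opprD addNKr.
congr (- _); apply: eq_bigr => v /negPf nv.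
by rewrite ffunE nv subn0.
Qed.

Fact E_op_homog z a e : E_homog a e -> E_homog (deg_t (val z) + a) (E_op z e).
Proof.
move=> he; rewrite -[e]freeg_sumE linear_sum big_seq.
apply: E_homog_sum => k /he <-; rewrite freeg_scaleU linearZ.
apply: E_homogS; rewrite /= E_op_U.
by apply: E_homogD; [exact: lau_act_homog | exact: inv_act_homog].
Qed.

Definition E_ops (k : 'I_npstar) : {linear carrier -> carrier} :=
  E_op (enum_val k).

Fact E_opsC i j e : E_ops i (E_ops j e) = E_ops j (E_ops i e).
Proof. exact: E_opC. Qed.

Fact op_mnm_homog m a e :
  E_homog a e -> E_homog (deg_mnm m + a) (op_mnm E_ops m e).
Proof.
move=> he; rewrite /deg_mnm /op_mnm -[X in X + _]big_enum /=.
elim: (enum _) => [|i s IH]; first by rewrite big_nil add0r.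
rewrite big_cons /= -addrA; move: (foldr _ _ _) (_ + a) IH => u b hu.
elim: (m i) => [|n IH]; first by rewrite add0r.
by rewrite mulrS -addrA; apply: E_op_homog.
Qed.

Definition E_mod : lmodType polyS := opmod E_opsC.

Fact E_homogZ (a b : zdeg) (p : polyS) (e : E_mod) :
  homog_poly b p -> E_homog a e -> E_homog (b + a) (p *: e).
Proof.
move=> hp he; change (E_homog (b + a) (op_scale E_ops p e)).
rewrite /op_scale big_seq; apply: E_homog_sum => m /hp <-.
by apply: E_homogS; apply: op_mnm_homog.
Qed.

Definition E_part (e : carrier) (a : zdeg) : carrier :=
  \sum_(k <- dom e | deg_mon k == a) << coeff k e *g k >>.

Fact E_homog_part e a : E_homog a (E_part e a).
Proof.
apply: E_homog_sum => k /eqP <-; rewrite freeg_scaleU.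
exact/E_homogS/E_homogU.
Qed.

Fact E_span (e : E_mod) : exists (s : seq zdeg) (f : zdeg -> E_mod),
  (forall a, E_homog a (f a)) /\ e = \sum_(a <- s) f a.
Proof.
exists (undup [seq deg_mon k | k <- dom e]), (E_part e); split.
  exact: E_homog_part.
change (e = \sum_(a <- undup [seq deg_mon k | k <- dom e]) E_part e a :> carrier).
rewrite -{1}[e : carrier]freeg_sumE /E_part (exchange_big_dep predT) //=.
apply: eq_big_seq => k ke.
under eq_bigl do rewrite eq_sym.
rewrite -big_filter filter_pred1_uniq ?undup_uniq ?mem_undup ?map_f //.
by rewrite big_seq1.
Qed.

Fact E_free (s : seq zdeg) (f : zdeg -> E_mod) : uniq s ->
  (forall a, E_homog a (f a)) -> \sum_(a <- s) f a = 0 ->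
  forall a, a \in s -> f a = 0.
Proof.
move=> us hf s0 a as_; apply/eqP/(@freeg_eqP K mon) => k; rewrite coeff0.
case: (boolP (k \in dom (f a : carrier))) => [kf|/coeff_outdom //].
have := congr1 (coeff k) (s0 : \sum_(a <- s) (f a : carrier) = 0).
rewrite raddf_sum /= coeff0 (bigD1_seq a) //= big1 ?addr0 // => b ba.
apply: coeff_outdom; apply/negP => /(hf b) e.
by move: ba; rewrite -e (hf a k kf) eqxx.
Qed.

Definition E_at : gradedModule :=
  @GradedModule E_mod E_homog E_homog0 E_homogD E_homogZ E_span E_free.

(* The K-span of the monomials u (x) v with deg_Z v = -i for some i >= 1,
   in nonnegative Z^n-degree. *)
Definition calL (e : E_at) : Prop :=
  forall k : mon, k \in dom (e : carrier) ->
    (exists2 i : nat, (1 <= i)%N & total_deg (deg_inv k.2) = - i%:Z) /\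
    nonneg_deg (deg_mon k).

End Ex.

Section DirectSum.
Context (I : finType) (M : I -> gradedModule).

Definition dsum_type : Type := {dffun forall i : I, M i}.
HB.instance Definition _ := Choice.on dsum_type.
Implicit Types u v w : dsum_type.

Definition dsum_add u v : dsum_type := [ffun i => u i + v i].
Definition dsum_opp u : dsum_type := [ffun i => - u i].
Definition dsum_zero : dsum_type := [ffun i => 0].
Definition dsum_scale (p : polyS) u : dsum_type := [ffun i => p *: u i].

Fact dsum_addA : associative dsum_add.
Proof. by move=> u v w; apply/ffunP => i; rewrite !ffunE addrA. Qed.
Fact dsum_addC : commutative dsum_add.
Proof. by move=> u v; apply/ffunP => i; rewrite !ffunE addrC. Qed.
Fact dsum_add0 : left_id dsum_zero dsum_add.
Proof. by move=> u; apply/ffunP => i; rewrite !ffunE add0r. Qed.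
Fact dsum_addN : left_inverse dsum_zero dsum_opp dsum_add.
Proof. by move=> u; apply/ffunP => i; rewrite !ffunE addNr. Qed.

HB.instance Definition _ := GRing.isZmodule.Build dsum_type
  dsum_addA dsum_addC dsum_add0 dsum_addN.

Fact dsum_scaleA p q u : dsum_scale p (dsum_scale q u) = dsum_scale (p * q) u.
Proof. by apply/ffunP => i; rewrite !ffunE scalerA. Qed.
Fact dsum_scale1 : left_id 1 dsum_scale.
Proof. by move=> u; apply/ffunP => i; rewrite !ffunE scale1r. Qed.
Fact dsum_scaleDr : right_distributive dsum_scale +%R.
Proof. by move=> p u v; apply/ffunP => i; rewrite !ffunE scalerDr. Qed.
Fact dsum_scaleDl u : {morph dsum_scale^~ u : p q / p + q}.
Proof. by move=> p q; apply/ffunP => i; rewrite !ffunE scalerDl. Qed.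

HB.instance Definition _ := GRing.Zmodule_isLmodule.Build polyS dsum_type
  dsum_scaleA dsum_scale1 dsum_scaleDr dsum_scaleDl.

Definition dsum_homog (a : zdeg) u : Prop := forall i, homogeneous a (u i).

Fact dsum_homog0 a : dsum_homog a 0.
Proof. by move=> i; rewrite ffunE; exact: homog0. Qed.

Fact dsum_homogD a u v : dsum_homog a u -> dsum_homog a v -> dsum_homog a (u + v).
Proof. by move=> hu hv i; rewrite ffunE; apply: homogD. Qed.

Fact dsum_homogZ a b p u :
  homog_poly b p -> dsum_homog a u -> dsum_homog (b + a) (p *: u).
Proof. by move=> hp hu i; rewrite ffunE; apply: homogZ. Qed.

Fact dsum_sumE J (r : seq J) (F : J -> dsum_type) i :
  (\sum_(j <- r) F j) i = \sum_(j <- r) F j i.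
Proof.
elim: r => [|j r IH]; first by rewrite !big_nil ffunE.
by rewrite !big_cons ffunE IH.
Qed.

Definition dsum_inj i (x : M i) : dsum_type :=
  [ffun j => if i =P j is ReflectT e then ecast j (M j) e x else 0].

Fact dsum_injE i (x : M i) : dsum_inj x i = x.
Proof. by rewrite ffunE; case: eqP => // e; rewrite eq_axiomK. Qed.

Fact dsum_inj_neq i j (x : M i) : i != j -> dsum_inj x j = 0.
Proof. by rewrite ffunE; case: eqP. Qed.

Fact dsum_span u : exists (s : seq zdeg) (f : zdeg -> dsum_type),
  (forall a, dsum_homog a (f a)) /\ u = \sum_(a <- s) f a.
Proof.
have homog_sum a J (r : seq J) (F : J -> dsum_type) :
    (forall j, dsum_homog a (F j)) -> dsum_homog a (\sum_(j <- r) F j).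
  by move=> hF; elim/big_rec: _ => [|j v _ hv];
     [exact: dsum_homog0 | exact: dsum_homogD].
have span1 i : exists (s : seq zdeg) (f : zdeg -> dsum_type),
    (forall a, dsum_homog a (f a)) /\ dsum_inj (u i) = \sum_(a <- s) f a.
  have [s [f [hf uE]]] := homog_span (u i).
  exists s, (fun a => dsum_inj (f a)); split=> [a j|].
    have [<-|nij] := eqVneq i j; first by rewrite dsum_injE.
    by rewrite dsum_inj_neq //; exact: homog0.
  apply/ffunP => j; rewrite dsum_sumE.
  have [<-|nij] := eqVneq i j.
    by rewrite dsum_injE uE; apply: eq_bigr => a _; rewrite dsum_injE.
  by rewrite dsum_inj_neq // big1 // => a _; rewrite dsum_inj_neq.
have spanr (r : seq I) : exists (s : seq zdeg) (f : zdeg -> dsum_type),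
    (forall a, dsum_homog a (f a)) /\
    \sum_(i <- r) dsum_inj (u i) = \sum_(a <- undup s) f a.
  elim: r => [|i r [s [f [hf sE]]]].
    by exists [::], (fun=> 0); split=> [a|]; [exact: dsum_homog0|rewrite !big_nil].
  have [s' [f' [hf' sE']]] := span1 i.
  pose g a := (if a \in s then f a else 0) +
    \sum_(b <- s' | b == a) f' a.
  exists (s ++ s'), g; split=> [a|].
    apply: dsum_homogD; first by case: ifP => _; [exact: hf | exact: dsum_homog0].
    by rewrite -big_filter; apply: homog_sum.
  rewrite big_cons sE' sE addrC big_split /=; congr (_ + _).
    rewrite -big_mkcond -[RHS]big_filter; apply: perm_big; apply: uniq_perm.
    - exact: undup_uniq.
    - exact/filter_uniq/undup_uniq.
    - by move=> a; rewrite mem_filter !mem_undup mem_cat; case: (a \in s).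
  rewrite (exchange_big_dep predT) //=; apply: eq_big_seq => a as'.
  under eq_bigl do rewrite eq_sym.
  rewrite -big_filter filter_pred1_uniq ?undup_uniq ?mem_undup ?mem_cat ?as' ?orbT //.
  by rewrite big_seq1.
have [s [f [hf sE]]] := spanr (index_enum I).
exists (undup s), f; split=> //; rewrite -sE; apply/ffunP => i.
rewrite dsum_sumE (bigD1 i) //= dsum_injE big1 ?addr0 // => j ji.
by rewrite dsum_inj_neq.
Qed.

Fact dsum_free (s : seq zdeg) (f : zdeg -> dsum_type) : uniq s ->
  (forall a, dsum_homog a (f a)) -> \sum_(a <- s) f a = 0 ->
  forall a, a \in s -> f a = 0.
Proof.
move=> us hf s0 a as_; apply/ffunP => i; rewrite [RHS]ffunE.
apply: (@homog_free (M i) s (fun b => f b i) us _ _ a as_) => [b|].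
  exact: hf.
by rewrite -dsum_sumE s0 ffunE.
Qed.

Definition dsum : gradedModule :=
  @GradedModule dsum_type dsum_homog
    dsum_homog0 dsum_homogD dsum_homogZ dsum_span dsum_free.
End DirectSum.

(* An I-indexed family of points, repetitions allowed, presents a direct sum
   of copies of the E_x. *)
Definition E_sum (I : finType) (xs : I -> P) : gradedModule :=
  dsum (fun i => E_at (xs i)).

Definition bases : Type := forall x : P, gaut (E_at x).

Definition calL_sum (sigma : bases) (I : finType) (xs : I -> P)
    (e : E_sum xs) : Prop :=
  forall i, exists2 e', calL e' & sigma (xs i) e' = (e : dsum_type _) i.

Definition clean (sigma : bases) (I J : finType) (xs : I -> P) (ys : J -> P)
    (psi : ghom (E_sum xs) (E_sum ys)) : Prop :=
  forall e, calL_sum sigma e -> calL_sum sigma (psi e).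

Definition deg_w : zdeg := \sum_(z : pstar) deg_t (val z).

Definition cocycle (D : nat -> gradedModule) (d : forall i, ghom (D i.+1) (D i))
    (i : nat) : D i -> Prop :=
  match i with
  | 0 => fun=> True
  | j.+1 => fun u => d j u = 0
  end.

(* Homological indexing: [dc_mod i] sits in cohomological degree -i, so the
   differential out of degree 0 has target 0 and is left out. *)
Record dualizingComplex := DualizingComplex {
  dc_mod : nat -> gradedModule;
  dc_diff : forall i, ghom (dc_mod i.+1) (dc_mod i);
  dc_diffK : forall i u, dc_diff i (dc_diff i.+1 u) = 0;
  dc_bounded : forall i, (npstar < i)%N -> forall u : dc_mod i, u = 0;
  dc_injective : forall i, ginjective (dc_mod i);
  dc_aug : ghom (shift regular_gm (- deg_w)) (dc_mod npstar);
  dc_aug_inj : injective dc_aug;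
  dc_exact_aug : forall u : dc_mod npstar,
    cocycle dc_diff u <-> exists p, dc_aug p = u;
  dc_exact : forall i, (i < npstar)%N -> forall u : dc_mod i,
    cocycle dc_diff u <-> exists v, dc_diff i v = u;
  dc_minimal : forall i, essential (@cocycle dc_mod dc_diff i)
}.

Definition rank_set (i : nat) : Type := {x : P | rank x == i}.
HB.instance Definition _ i := Finite.on (rank_set i).

Definition rank_pt (i : nat) (x : rank_set i) : P := val x.

Definition E_rank (i : nat) : gradedModule := E_sum (@rank_pt i).

(* An isomorphism from \bigoplus_(rank x = i) E_x onto the graded submodule
   Gamma (D i), written as an embedding into D i. *)
Record identification (D : dualizingComplex) (i : nat) := Identification {
  id_hom :> ghom (E_rank i) (dc_mod D i);
  id_inj : injective id_hom;
  id_image : forall u, Gamma u <-> exists e, id_hom e = u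
}.

(* The differential of Gamma (D) from degree -(i + 1) to degree -i, read
   through the identifications. *)
Section GammaDiff.
Context (D : dualizingComplex) (phi : forall i, identification D i) (i : nat).

Fact gamma_diff_ex (e : E_rank i.+1) :
  exists e', phi i e' == dc_diff D i (phi i.+1 e).
Proof.
suff /(id_image (phi i))[e' <-] : Gamma (dc_diff D i (phi i.+1 e)) by exists e'.
have [k hk] : Gamma (phi i.+1 e) by apply/(id_image (phi i.+1)); exists e.
by exists k => p /hk pe; rewrite -linearZ pe linear0.
Qed.

Definition gamma_diff_fun (e : E_rank i.+1) : E_rank i :=
  xchoose (gamma_diff_ex e).

Fact gamma_diffE e : phi i (gamma_diff_fun e) = dc_diff D i (phi i.+1 e).
Proof. exact/eqP/(xchooseP (gamma_diff_ex e)). Qed.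

Fact gamma_diff_linear p u v :
  gamma_diff_fun (p *: u + v) = p *: gamma_diff_fun u + gamma_diff_fun v.
Proof. by apply: (@id_inj _ _ (phi i)); rewrite linearP !gamma_diffE !linearP. Qed.

HB.instance Definition _ := GRing.isLinear.Build polyS (E_rank i.+1) (E_rank i)
  *:%R gamma_diff_fun gamma_diff_linear.

Fact gamma_diff_homog a e : homogeneous a e -> homogeneous a (gamma_diff_fun e).
Proof.
move=> he; apply: (ghom_inj_homog (@id_inj _ _ (phi i))).
by rewrite gamma_diffE; do 2!apply: ghomP.
Qed.

Definition gamma_diff : ghom (E_rank i.+1) (E_rank i) :=
  @GHom _ _ gamma_diff_fun gamma_diff_homog.
End GammaDiff.
End FaceRing.

(* Main.v *)
Require Import Defs.
From HB Require Import structures.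
From mathcomp Require Import all_boot all_order all_algebra.
From mathcomp Require Import freeg mpoly.
From mathcomp Require Import zify.

(** In degree 0, the module E_x is an inverse system over the power series in
    the elements s_z, where s_z is t_z divided by the product of the t_i with
    i in supp z, lowered by 1 if z <= x; here z runs over the elements of rank
    at least 2 with supp z contained in supp x.  Its socle is spanned by the
    monomial 1, and multiplication by monomials in the t_i moves every
    nonnegative degree to degree 0.  Up to this translation, L(E_x) is the
    kernel of the linear form that reads off the coefficient of 1.  By Matlis
    duality any linear form is obtained from this one by letting a power series
    act, and the power series is invertible exactly if the form does not vanish
    on the socle ([straightening], [coeff_series]).  So choosing a basis of E_x
    amounts to choosing a linear form lambda_x with lambda_x(1) <> 0, and the
    bases are clean as soon as lambda_y o d_xy is a multiple of lambda_x for
    every component d_xy : E_x -> E_y of the differential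
    ([clean_component_mon]).

    The component d_xy vanishes unless y <= x ([E_hom_out]), and it maps the
    socle to the socle ([killed_socle]), hence 1 to c_xy times 1.  Suppose that
    c_xy <> 0 whenever y <= x.  Then put lambda_x = lambda_y o d_xy for some
    y < x of corank 1, starting from the coefficient of 1 in rank 0
    ([socle_form]).  Another choice of y changes lambda_x only by a factor: two
    such elements are the whole middle layer of an interval [w, x] of
    length 2, so d o d = 0 leaves d_(y1 w) d_(x y1) = - d_(y2 w) d_(x y2)
    ([gcomp_diamond], [socle_form_gcomp]).

    For c_xy <> 0 the same relation, applied to the monomial 1, shows that for
    fixed x either all c_xy vanish or none does ([cov_coeff_neq0]).  So it is
    enough that the monomial 1 of E_x is not a cocycle when x is not the least
    element ([gamma_diff_one_neq0]).  As Hom(S/p_x, D) has nothing in the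
    preceding degree, such a cocycle would be a nonzero element of degree 0 in
    Ext(S/p_x, S(-w)) in cohomological degree N - rank x.  But p_x is generated
    by the regular sequence of the t_z minus their images under pi_x, for z not
    a vertex of x, so that this Ext is S_x shifted by minus the sum of the e_i
    with i in supp x, and has no element of degree 0.  The shift is computed
    directly on the injective resolution ([koszul_vanishing]). *)

Set Implicit Arguments.
Unset Strict Implicit.
Unset Printing Implicit Defensive.

Import Order.TTheory GRing.Theory Num.Theory.
Local Open Scope ring_scope.

(** * Simplicial posets *)

Section Poset.
Context {d : Order.disp_t} {P : simplicialPoset d}.
Local Notation npstar := #|{: pstar P}|.

(** [f] is a total function, constrained only below [x], so that elements
    below [x] need not be packaged with their proofs. *)
Definition is_chart (x : P) (f : P -> {set 'I_(rank x)})
    (g : {set 'I_(rank x)} -> P) : Prop :=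
  [/\ forall A, (g A <= x)%O, cancel g f, {in [pred y | (y <= x)%O], cancel f g} &
      {in [pred y | (y <= x)%O] &, forall y z, (y <= z)%O = (f y \subset f z)}].

Lemma boolean_chart (x : P) : exists f g, @is_chart x f g.
Proof.
have [f [[g fK gK] fle]] := boolean_rank x.
exists (fun y => if insub y is Some y' then f y' else set0), (fun A => val (g A)).
split=> [A|A|y yx|y z yx zx]; first exact: (valP (g A)).
- by rewrite valK gK.
- by rewrite insubT /= fK.
- by rewrite !insubT /= -fle.
Qed.

Lemma card_below (x : P) : #|[pred y | (y <= x)%O]| = (2 ^ rank x)%N.
Proof.
have [f [g [gx gK fK fle]]] := boolean_chart x.
have <- : #|[set: {set 'I_(rank x)}]| = (2 ^ rank x)%N.
  by rewrite -powersetT card_powerset cardsT card_ord.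
rewrite -(card_imset _ (can_inj gK)); apply: eq_card => y.
apply/idP/imsetP => [yx|[A _ ->]]; last exact: gx.
by exists (f y); rewrite ?inE ?fK.
Qed.

Lemma rank_chart (x : P) f g : @is_chart x f g -> forall A, rank (g A) = #|A|.
Proof.
move=> [gx gK fK fle] A; apply: (@expnI 2) => //.
rewrite -card_below -card_powerset -(card_imset _ (can_inj gK)).
apply: eq_card => y; apply/idP/imsetP => [|[B]].
  rewrite inE => yA; have yx : (y <= x)%O := le_trans yA (gx A).
  by exists (f y); rewrite ?fK // powersetE -[A]gK -fle ?inE ?gx.
by rewrite powersetE => BA ->; rewrite inE fle ?inE ?gx // !gK.
Qed.

Lemma rank_bot : rank (\bot%O : P) = 0%N.
Proof.
apply: (@expnI 2) => //; rewrite -card_below expn0 -(card1 (\bot%O : P)).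
by apply: eq_card => y; rewrite !inE lex0.
Qed.

Lemma rank_eq0 (x : P) : (rank x == 0%N) = (x == \bot%O).
Proof.
apply/eqP/eqP => [r0|->]; last exact: rank_bot.
have /card_le1_eqP h : (#|[pred y | (y <= x)%O]| <= 1)%N by rewrite card_below r0.
by apply: h; rewrite inE.
Qed.

Lemma rank_lt (x y : P) : (x < y)%O -> (rank x < rank y)%N.
Proof.
move=> xy; rewrite -(@ltn_exp2l 2) // -!card_below; apply: proper_card.
apply/properP; split.
  by apply/subsetP => z; rewrite !inE => /le_trans; apply; apply: ltW.
by exists y; rewrite !inE ?lexx ?lt_geF.
Qed.

Lemma vertex_neq_bot (i : vertex P) : val i != \bot%O.
Proof. by apply/eqP => e; have := valP i; rewrite e rank_bot. Qed.

Definition vtx (i : vertex P) : pstar P := Sub (val i) (vertex_neq_bot i).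
Definition vidx (i : vertex P) : 'I_npstar := enum_rank (vtx i).

Lemma val_vidx i : val (enum_val (vidx i)) = val i.
Proof. by rewrite enum_rankK. Qed.

Definition isvtx (x : P) (k : 'I_npstar) : bool :=
  (rank (val (enum_val k : pstar P)) == 1%N) && (val (enum_val k) <= x)%O.

Lemma isvtx_vidx x i : isvtx x (vidx i) = (i \in supp x).
Proof. by rewrite /isvtx val_vidx inE (valP i). Qed.

Lemma isvtxP x k : reflect (exists2 i, i \in supp x & k = vidx i) (isvtx x k).
Proof.
apply: (iffP idP) => [/andP[r1 kx]|[i ix ->]]; last by rewrite isvtx_vidx.
exists (Sub (val (enum_val k)) r1); first by rewrite inE.
by apply: enum_val_inj; apply: val_inj; rewrite val_vidx.
Qed.

Lemma supp_vertex (i j : vertex P) : (i \in supp (val j)) = (i == j).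
Proof.
rewrite inE; apply/idP/eqP => [ij|->] //.
apply: val_inj; case: (eqVneq (val i) (val j)) => // ne.
have /rank_lt : (val i < val j)%O by rewrite lt_neqAle ne.
by rewrite (eqP (valP i)) (eqP (valP j)).
Qed.

Lemma deg_t_vertex (i j : vertex P) : deg_t (val i) j = (i == j)%:R.
Proof. by rewrite ffunE supp_vertex eq_sym. Qed.

Lemma deg_t_sum_supp (x : P) : deg_t x = \sum_(i in supp x) deg_t (val i).
Proof.
apply/ffunP => j; rewrite sum_ffunE; under eq_bigr do rewrite deg_t_vertex.
rewrite ffunE; case: (boolP (j \in supp x)) => jx.
  by rewrite (bigD1 j) //= eqxx big1 ?addr0 // => i /andP[_ /negPf->].
by rewrite big1 // => i ix; case: eqP => // e; rewrite -e ix in jx.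
Qed.

(** Below a common upper bound, an element is the join of its vertices.  This
    fails in a simplicial poset without the bound [x]. *)
Lemma supp_sub_le (x y z : P) : (z <= x)%O -> (y <= x)%O ->
  supp z \subset supp y -> (z <= y)%O.
Proof.
have [f [g fgP]] := boolean_chart x; have gr := rank_chart fgP.
case: fgP => gx gK fK fle zx yx /subsetP zy; rewrite fle ?inE //.
apply/subsetP => a az; have ra : rank (g [set a]) == 1%N by rewrite gr cards1.
have g_le t : (t <= x)%O -> (g [set a] <= t)%O = (a \in f t).
  by move=> tx; rewrite fle ?inE ?gx // gK sub1set.
by have := zy (Sub (g [set a]) ra); rewrite !inE /= !g_le // => ->.
Qed.

Lemma supp_neq0 (x : P) : x != \bot%O -> exists i, i \in supp x.
Proof.
move=> x0; apply/set0Pn; apply: contraNneq x0 => sx0; rewrite -lex0.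
by apply: (@supp_sub_le x); rewrite ?sx0 ?sub0set ?le0x.
Qed.

Lemma card_supp (x : P) : #|supp x| = rank x.
Proof.
have [f [g fgP]] := boolean_chart x; have gr := rank_chart fgP.
case: fgP => gx gK fK fle.
have ra a : rank (g [set a]) == 1%N by rewrite gr cards1.
pose h a : vertex P := Sub (g [set a]) (ra a).
rewrite -[rank x]card_ord -cardsT -(@card_imset _ _ h); last first.
  by move=> a b /(congr1 val)/(can_inj gK)/set1_inj.
apply: eq_card => i; apply/idP/imsetP => [|[a _ ->]]; last by rewrite inE gx.
rewrite inE => ix; have /cards1P[a fa] : #|f (val i)| == 1%N.
  by rewrite -gr fK ?(valP i).
by exists a => //; apply: val_inj; rewrite /= -fa fK.
Qed.

Definition nonvtx (x : P) : seq 'I_#|{: pstar P}| :=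
  [seq j <- enum 'I_#|{: pstar P}| | ~~ isvtx x j].

Lemma mem_nonvtx (x : P) j : (j \in nonvtx x) = ~~ isvtx x j.
Proof. by rewrite mem_filter mem_enum andbT. Qed.

Lemma size_nonvtx (x : P) : (rank x + size (nonvtx x))%N = #|{: pstar P}|.
Proof.
have vidx_inj : injective vidx.
  by move=> i j /enum_rank_inj/(congr1 val) /= e; apply: val_inj.
rewrite -card_supp -(card_imset _ vidx_inj).
have /card_uniqP <- : uniq (nonvtx x) by rewrite filter_uniq ?enum_uniq.
rewrite -[RHS]card_ord -(cardC [pred j | isvtx x j]); congr (_ + _)%N.
  by apply: eq_card => j; apply/imsetP/isvtxP => [][i]; exists i.
by apply: eq_card => j; rewrite mem_nonvtx.
Qed.

Lemma deg_w_nonvtx (x : P) : deg_w P =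
  \sum_(i in supp x) deg_t (val i) + \sum_(j <- nonvtx x) deg_t (val (enum_val j)).
Proof.
rewrite /deg_w (reindex_onto (@enum_val _ _) (@enum_rank (pstar P))) /=; last first.
  by move=> z _; rewrite enum_rankK.
rewrite (eq_bigl predT) => [|j]; last by rewrite enum_valK eqxx.
rewrite (bigID (isvtx x)) /=; congr (_ + _); last first.
  by rewrite /nonvtx big_filter big_enum_cond.
rewrite (reindex_omap vidx (fun j => insub (val (enum_val j)))) /=.
  apply: eq_big => [i|i _]; rewrite ?val_vidx // isvtx_vidx valK eqxx andbT //.
by move=> j /isvtxP[i ix ->]; rewrite val_vidx valK.
Qed.

(** In a boolean lattice [y1] and [y2] are complements of points, and [w] is
    the complement of the two points. *)
Lemma rank_diamond (x y1 y2 : P) : y1 != y2 -> (y1 <= x)%O -> (y2 <= x)%O ->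
  (rank y1).+1 = rank x -> (rank y2).+1 = rank x ->
  exists w, [/\ (rank w).+2 = rank x, (w <= y1)%O, (w <= y2)%O &
    forall y, (w <= y)%O -> (y <= x)%O -> (rank y).+1 = rank x -> y = y1 \/ y = y2].
Proof.
have [f [g fgP]] := boolean_chart x; have gr := rank_chart fgP.
case: fgP => gx gK fK fle.
have coatom y : (y <= x)%O -> (rank y).+1 = rank x -> exists j, f y = [set~ j].
  move=> yx ry; have /cards1P[j fj] : #|~: f y| == 1%N.
    by rewrite cardsCs setCK card_ord -gr fK // -ry subSn ?subnn.
  by exists j; rewrite -fj setCK.
move=> y12 y1x y2x r1 r2; have [j1 f1] := coatom _ y1x r1; have [j2 f2] := coatom _ y2x r2.
have j12 : j1 != j2.
  by apply: contraNneq y12 => j12; rewrite -(fK y1) // -(fK y2) // f1 f2 j12.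
exists (g (~: [set j1; j2])); split.
- rewrite gr cardsCs setCK card_ord cards2 j12.
  have : (1 < rank x)%N.
    by have := subset_leq_card (subsetT [set j1; j2]); rewrite cards2 j12 cardsT card_ord.
  by case: (rank x) => // [[|n]] // _; rewrite !subSS subn0.
- by rewrite fle ?inE ?gx // gK f1 setCS sub1set set21.
- by rewrite fle ?inE ?gx // gK f2 setCS sub1set set22.
- move=> y wy yx ry; have [j fj] := coatom _ yx ry.
  move: wy; rewrite fle ?inE ?gx // gK fj setCS sub1set !inE => /orP[]/eqP jE; [left|right].
    by rewrite -(fK y) // -(fK y1) // fj f1 jE.
  by rewrite -(fK y) // -(fK y2) // fj f2 jE.
Qed.

End Poset.

(** * Polynomials and homogeneous elements *)

Lemma mpoly_ring_ind (n : nat) (R : nzRingType) (Q : {mpoly R[n]} -> Prop) :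
  (forall c, Q c%:MP) -> (forall k, Q 'X_k) ->
  (forall p q, Q p -> Q q -> Q (p + q)) ->
  (forall p q, Q p -> Q q -> Q (p * q)) -> forall p, Q p.
Proof.
move=> QC QX QD QM; have Qexp k i : Q ('X_k ^+ i).
  elim: i => [|i IH]; first by rewrite expr0 -mpolyC1.
  by rewrite exprS; apply: (QM).
elim/mpolyind => [|c m p _ _ Qp]; first by rewrite -mpolyC0.
apply: (QD _ _ _ Qp); rewrite -mul_mpolyC; apply: (QM) => //.
rewrite mpolyXE_id; elim/big_rec: _ => [|k q _ Qq]; last exact: QM.
by rewrite -mpolyC1.
Qed.

Section Polynomials.
Context {d : Order.disp_t} {P : simplicialPoset d} {K : fieldType}.
Local Notation npstar := #|{: pstar P}|.
Local Notation polyS := {mpoly K[npstar]}.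
Local Notation zdeg := {ffun vertex P -> int}.

Lemma scale_additive_linear (M N : lmodType polyS) (g : M -> N) :
  {morph g : u v / u + v} ->
  (forall c u, g (c%:MP *: u) = c%:MP *: g u) ->
  (forall k u, g ('X_k *: u) = 'X_k *: g u) ->
  forall p u, g (p *: u) = p *: g u.
Proof.
move=> gD gC gX; elim/mpoly_ring_ind => // p q IHp IHq u.
- by rewrite !scalerDl gD IHp IHq.
- by rewrite -!scalerA IHp IHq.
Qed.

Lemma homog_polyC c : homog_poly (0 : zdeg) (c%:MP : polyS).
Proof.
move=> m; rewrite msuppC; case: ifP => //= _; rewrite inE => /eqP->.
by rewrite /deg_mnm big1 // => k _; rewrite mnm0E.
Qed.

Lemma deg_mnmU k : deg_mnm U_(k)%MM = deg_t (val (enum_val k : pstar P)).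
Proof.
rewrite /deg_mnm (bigD1 k) //= mnm1E eqxx big1 ?addr0 // => j jk.
by rewrite mnm1E eq_sym (negPf jk).
Qed.

Lemma homog_polyX k :
  homog_poly (deg_t (val (enum_val k : pstar P))) ('X_k : polyS).
Proof. by move=> m; rewrite msuppX inE => /eqP->; rewrite deg_mnmU. Qed.

Lemma homog_poly_prod (I : Type) (r : seq I) (a : I -> zdeg) (F : I -> polyS)
    (Q : pred I) :
  (forall i, Q i -> homog_poly (a i) (F i)) ->
  homog_poly (\sum_(i <- r | Q i) a i) (\prod_(i <- r | Q i) F i).
Proof.
move=> hF; elim: r => [|i r IH].
  by rewrite !big_nil -mpolyC1; apply: homog_polyC.
by rewrite !big_cons; case: ifP => // Qi; apply: homog_polyM; [apply: hF|].
Qed.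

Lemma homog_polyXn a (p : polyS) n :
  homog_poly a p -> homog_poly (a *+ n) (p ^+ n).
Proof.
move=> hp; elim: n => [|n IH]; last by rewrite mulrS exprS; apply: homog_polyM.
by rewrite expr0 -mpolyC1; apply: homog_polyC.
Qed.

Lemma deg_mnm_ge0 m i : 0 <= (deg_mnm m : zdeg) i.
Proof.
rewrite /deg_mnm sum_ffunE sumr_ge0 // => k _.
by rewrite ffunMnE mulrn_wge0 // ffunE; case: (_ \in _).
Qed.

(** Only the component of [v] in degree [a] contributes to [f v]. *)
Lemma ghom_homog_preimage (M N : gradedModule P K) (f : ghom M N) a v :
  homogeneous a (f v) -> exists2 v', homogeneous a v' & f v' = f v.
Proof.
move=> hfv; have [s [g [hg vE]]] := homog_span v.
pose r := undup (a :: s); pose part b := \sum_(c <- s | c == b) g c.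
have hpart b : homogeneous b (part b).
  by rewrite /part; elim/big_rec: _ => [|c u /eqP <- hu];
     [exact: homog0 | exact: homogD].
have ur : uniq r by apply: undup_uniq.
have ar : a \in r by rewrite mem_undup mem_head.
have {}vE : v = \sum_(b <- r) part b.
  rewrite {1}vE (exchange_big_dep predT) //=; apply: eq_big_seq => c cs.
  under eq_bigl do rewrite eq_sym.
  rewrite -big_filter filter_pred1_uniq ?big_seq1 //.
  by rewrite mem_undup inE cs orbT.
pose h b := f (part b) - (if b == a then f v else 0).
have hh b : homogeneous b (h b).
  apply: homogD; first exact: ghomP.
  rewrite -scaleN1r -[b]add0r; apply: homogZ; last first.
    by rewrite add0r; case: eqP => [->|_] //; exact: homog0.
  by rewrite -mpolyC1 -mpolyCN; apply: homog_polyC.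
have h0 : \sum_(b <- r) h b = 0.
  rewrite big_split sumrN -linear_sum -vE -big_mkcond -big_filter.
  by rewrite filter_pred1_uniq // big_seq1; exact: subrr.
exists (part a) => //; apply/eqP; rewrite -subr_eq0.
by have := homog_free ur hh h0 ar; rewrite /h eqxx => ->.
Qed.

Lemma homogB (M : gradedModule P K) a (u v : M) :
  homogeneous a u -> homogeneous a v -> homogeneous a (u - v).
Proof.
move=> hu hv; apply: homogD => //; rewrite -scaleN1r -[a]add0r; apply: homogZ => //.
by rewrite -mpolyC1 -mpolyCN; apply: homog_polyC.
Qed.

End Polynomials.

(** * Vanishing below a regular sequence *)

Section Shifting.
Context {d : Order.disp_t} {P : simplicialPoset d} (K : fieldType) (x : P).
Local Notation npstar := #|{: pstar P}|.
Local Notation polyS := {mpoly K[npstar]}.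
Local Notation zdeg := {ffun vertex P -> int}.
Local Notation degX k := (deg_t (val (enum_val k : pstar P))).

(** The image of the variable [k] in S/p_x, lifted to the polynomial ring in
    the vertices of [x]. *)
Definition pi_x (k : 'I_npstar) : polyS :=
  if (val (enum_val k) <= x)%O then
    \prod_(i in supp (val (enum_val k))) 'X_(vidx i) else 0.

(** For [k] not a vertex of [x], these generate p_x. *)
Definition rel_x (k : 'I_npstar) : polyS := 'X_k - pi_x k.

(** Eliminates the variables in [s] modulo the [rel_x k] with [k] in [s]. *)
Definition rho (s : seq 'I_npstar) : {rmorphism polyS -> polyS} :=
  mmap (@mpolyC npstar K) (fun k => if k \in s then pi_x k else 'X_k).

Lemma rhoC s c : rho s c%:MP = c%:MP.
Proof. exact: mmapC. Qed.

Lemma rhoX s k : rho s 'X_k = if k \in s then pi_x k else 'X_k.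
Proof. by rewrite /= mmapX mmap1U. Qed.

Lemma pi_x_homog k : homog_poly (degX k) (pi_x k).
Proof.
rewrite /pi_x; case: ifP => _; last exact: homog_poly0.
rewrite {1}deg_t_sum_supp; apply: homog_poly_prod => i _.
by rewrite -(val_vidx i); apply: homog_polyX.
Qed.

Lemma rel_x_homog k : homog_poly (degX k) (rel_x k).
Proof.
apply: (@homogB _ _ _ (regular_gm P K)); [exact: homog_polyX | exact: pi_x_homog].
Qed.

Lemma rho_homog s b p : homog_poly b p -> homog_poly b (rho s p).
Proof.
move=> hp; rewrite [p]mpolyE rmorph_sum big_seq.
elim/big_rec: _ => [|m q /hp <- hq]; first exact: homog_poly0.
apply: homog_polyD hq; rewrite -mul_mpolyC rmorphM rhoC mul_mpolyC.
suff h : homog_poly (deg_mnm m) (rho s 'X_[m]) by move=> m' /msuppZ_le /h.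
rewrite mpolyXE_id rmorph_prod; apply: homog_poly_prod => k _.
rewrite rmorphXn; apply: homog_polyXn; rewrite rhoX.
by case: ifP => _; [apply: pi_x_homog | apply: homog_polyX].
Qed.

Definition killed (s : seq 'I_npstar) (M : gradedModule P K) (u : M) : Prop :=
  forall k, k \in s -> rel_x k *: u = 0.

Lemma rho_scale s (M : gradedModule P K) (u : M) :
  killed s u -> forall p, rho s p *: u = p *: u.
Proof.
move=> hu; elim/mpoly_ring_ind => [c|k|p q hp hq|p q hp hq].
- by rewrite rhoC.
- rewrite rhoX; case: ifP => // /hu /eqP.
  by rewrite scalerBl subr_eq0 => /eqP.
- by rewrite rmorphD !scalerDl hp hq.
- by rewrite rmorphM -scalerA hq scalerA mulrC -scalerA hp scalerA mulrC.
Qed.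

(** S acting on itself through [rho s].  It serves as a substitute for the
    quotient of S by the [rel_x k] with [k] in [s], over which it is free: that
    [rel_x k] is a nonzerodivisor on it is just [rel_x_neq0], as S is a
    domain. *)
Definition rho_mod (s : seq 'I_npstar) : Type := polyS.
HB.instance Definition _ s := GRing.Zmodule.on (rho_mod s).

Section RhoModule.
Context (s : seq 'I_npstar).
Definition rho_mul (p : polyS) (q : rho_mod s) : rho_mod s := rho s p * (q : polyS).
Fact rho_mulA p q u : rho_mul p (rho_mul q u) = rho_mul (p * q) u.
Proof. by rewrite /rho_mul rmorphM mulrA. Qed.
Fact rho_mul1 : left_id 1 rho_mul.
Proof. by move=> u; rewrite /rho_mul rmorph1 mul1r. Qed.
Fact rho_mulDr : right_distributive rho_mul +%R.
Proof. by move=> p u v; rewrite /rho_mul mulrDr. Qed.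
Fact rho_mulDl u : {morph rho_mul^~ u : p q / p + q}.
Proof. by move=> p q; rewrite /rho_mul rmorphD mulrDl. Qed.
HB.instance Definition _ := GRing.Zmodule_isLmodule.Build polyS (rho_mod s)
  rho_mulA rho_mul1 rho_mulDr rho_mulDl.

Fact rho_mod_homogZ (a b : zdeg) (p : polyS) (u : rho_mod s) :
  homog_poly b p -> homog_poly a (u : polyS) ->
  homog_poly (b + a) ((p *: u : rho_mod s) : polyS).
Proof. by move=> hp hu; apply: homog_polyM => //; apply: rho_homog. Qed.

Definition rho_gm : gradedModule P K :=
  @GradedModule _ _ _ (rho_mod s : lmodType polyS) (fun a u => homog_poly a (u : polyS))
    (@homog_poly0 _ P K) (@homog_polyD _ P K) rho_mod_homogZ
    (@homog_poly_span _ P K) (@homog_poly_free _ P K).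
End RhoModule.

Lemma rho_pi s k : {in s, forall j, ~~ isvtx x j} -> rho s (pi_x k) = pi_x k.
Proof.
move=> hs; rewrite /pi_x; case: ifP => kx; last by rewrite rmorph0.
rewrite rmorph_prod; apply: eq_bigr => i; rewrite inE => ik.
rewrite rhoX; case: ifP => // /hs; rewrite isvtx_vidx inE.
by rewrite (le_trans ik kx).
Qed.

Lemma rel_x_neq0 s k : {in s, forall j, ~~ isvtx x j} -> ~~ isvtx x k ->
  k \notin s -> rho s (rel_x k) != 0.
Proof.
move=> hs hk ks; rewrite rmorphB rho_pi // rhoX (negPf ks).
apply/negP => /eqP/(congr1 (mcoeff U_(k)%MM)).
rewrite mcoeffB mcoeffX eqxx mcoeff0 /pi_x; case: ifP => kx; last first.
  by rewrite mcoeff0 subr0 => /eqP; rewrite oner_eq0.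
rewrite -(big_morph (@mpolyX _ _) (@mpolyXD _ _) (@mpolyX0 _ _)) mcoeffX.
case: eqP => [/mnmP/(_ k)|_]; last first.
  by rewrite subr0 => /eqP; rewrite oner_eq0.
rewrite mnm_sumE mnm1E eqxx big1 // => i; rewrite inE mnm1E => ik.
case: eqP => // e; move: hk; rewrite -e isvtx_vidx inE.
by rewrite (le_trans ik kx).
Qed.

(** The map [q |-> q *: g] on [rho_mod s] is linear because [s] kills [g].
    Extended along multiplication by the nonzerodivisor [rel_x k], it sends 1
    to an [h] as required. *)
Lemma killed_divisible s k (E : gradedModule P K) (g : E) a :
  ginjective E -> {in s, forall j, ~~ isvtx x j} -> ~~ isvtx x k -> k \notin s ->
  homogeneous (degX k + a) g -> killed s g ->
  exists h : E, [/\ homogeneous a h, killed s h & rel_x k *: h = g].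
Proof.
move=> Einj hs hk ks hg kg.
(* The shifts make both maps out of [A] preserve degrees. *)
pose A := shift (rho_gm s) (- (degX k + a)); pose B := shift (rho_gm s) (- a).
pose f0 (q : A) : B := rel_x k *: (q : rho_mod s).
have f0lin : linear f0.
  by move=> p u v; rewrite /f0 scalerDr !scalerA mulrC.
pose f1 : {linear A -> B} := HB.pack f0 (GRing.isLinear.Build _ _ _ _ f0 f0lin).
have f1P b u : homogeneous b u -> homogeneous b (f1 u).
  move=> hu; rewrite /homogeneous /= /shift_homog /=.
  have -> : - a + b = degX k + (- (degX k + a) + b).
    by rewrite opprD -!addrA addNKr.
  by apply: rho_mod_homogZ hu; apply: rel_x_homog.
pose g0 (q : A) : E := (q : polyS) *: g.
have g0lin : linear g0.
  move=> p u v; rewrite -[LHS]/((rho s p * (u : polyS) + v) *: g) scalerDl.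
  by rewrite mulrC -scalerA rho_scale // !scalerA mulrC.
pose g1 : {linear A -> E} := HB.pack g0 (GRing.isLinear.Build _ _ _ _ g0 g0lin).
have g1P b u : homogeneous b u -> homogeneous b (g1 u).
  move=> hu; have -> : b = (- (degX k + a) + b) + (degX k + a) by rewrite addrAC addNr add0r.
  exact: homogZ.
have f1inj : injective (GHom f1P).
  move=> u v; rewrite /= /f1 /= /f0; apply: mulfI; exact: rel_x_neq0.
have [h hE] := Einj A B (GHom f1P) (GHom g1P) f1inj.
pose one : B := (1 : polyS).
have relE j : rel_x j *: h one = h (rho s (rel_x j) : polyS).
  by rewrite -linearZ; congr (h _); exact: mulr1.
exists (h one); split.
- apply: ghomP; rewrite /homogeneous /= /shift_homog /= addNr /one -mpolyC1; exact: homog_polyC.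
- by move=> j js; rewrite relE rmorphB rhoX js rho_pi // subrr linear0.
- rewrite relE -[RHS]scale1r -[RHS]/(g1 1) -hE; congr (h _).
  by rewrite /= /f1 /= /f0; exact/esym/mulr1.
Qed.

(** Let D_s be the subcomplex of [D] killed by [rel_x k] for [k] in [s].  By
    [killed_divisible] the sequence 0 -> D_(k :: s) -> D_s -> D_s -> 0, whose
    surjection is multiplication by [rel_x k], is exact up to a degree shift, so
    the homology of D_(k :: s) is controlled by that of D_s one step higher.
    By induction the homology of D_s vanishes below position N - size s, and at
    that position in the degrees [b] in which S(-w), shifted by the degrees of
    the relations, is zero. *)
Lemma koszul_vanishing (D : dualizingComplex P K) s :
  uniq s -> {in s, forall j, ~~ isvtx x j} ->
  forall n (u : dc_mod D n) b, (n + size s <= npstar)%N ->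
  ((n + size s)%N = npstar -> exists i, (b + \sum_(k <- s) degX k) i < deg_w P i) ->
  homogeneous b u -> killed s u -> cocycle (dc_diff D) u ->
  exists e : dc_mod D n.+1, [/\ homogeneous b e, killed s e & dc_diff D n e = u].
Proof.
elim: s => [|k s IH] us hs n u b le_n bw hu ku zu.
  have [nN|nN] := ltnP n npstar.
    have [v vu] := (dc_exact nN u).1 zu.
    have [|e he eu] := @ghom_homog_preimage _ _ _ _ _ (dc_diff D n) b v; first by rewrite vu.
    by exists e; rewrite eu vu.
  have nE : n = npstar by apply/eqP; rewrite eqn_leq nN -[n]addn0 le_n.
  have {bw} [i bi] := bw (etrans (addn0 n) nE).
  subst n; have [p pu] := (dc_exact_aug u).1 zu.
  have hp : homog_poly (- deg_w P + b) p.
    by apply: (@ghom_inj_homog _ _ _ _ _ (dc_aug D) b p (@dc_aug_inj _ _ _ D)); rewrite pu.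
  have p0 : p = 0.
    apply/eqP; rewrite -msupp_eq0; case E: (msupp p) => [//|m r].
    have := deg_mnm_ge0 m i; rewrite (hp m) ?E ?mem_head // !ffunE.
    by rewrite big_nil addr0 in bi; rewrite addrC subr_ge0 leNgt bi.
  (* The cocycle is the image of a polynomial with a negative degree. *)
  exists 0; split; [exact: homog0 | by move=> ? | by rewrite -pu p0 !linear0].
have /andP[ks us'] := us.
have hs' : {in s, forall j, ~~ isvtx x j} by move=> j js; apply: hs; rewrite inE js orbT.
have hk : ~~ isvtx x k by apply: hs; rewrite mem_head.
have ku' : killed s u by move=> j js; apply: ku; rewrite inE js orbT.
rewrite /= addnS in le_n bw.
have [||e [he ke eu]] := IH us' hs' n u b _ _ hu ku' zu.
- exact: ltnW.
- by move=> e; rewrite e ltnn in le_n.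
(* [e] solves the problem for [s]; it is corrected by a boundary to be killed
   by [rel_x k] as well. *)
have hfe : homogeneous (degX k + b) (rel_x k *: e).
  by apply: homogZ he; apply: rel_x_homog.
have kfe : killed s (rel_x k *: e).
  by move=> j js; rewrite scalerA mulrC -scalerA ke // scaler0.
have zfe : cocycle (dc_diff D) (rel_x k *: e).
  by rewrite /= linearZ /= eu; apply: ku; rewrite mem_head.
have [||g [hg kg ge]] := IH us' hs' n.+1 (rel_x k *: e) _ _ _ hfe kfe zfe.
- by rewrite addSn.
- by move=> /bw[i]; rewrite big_cons addrA [b + _]addrC; exists i.
have [h [hh kh fh]] := killed_divisible (@dc_injective _ _ _ D _) hs' hk ks hg kg.
exists (e - dc_diff D n.+1 h); split.
- by apply: homogB => //; apply: ghomP.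
- move=> j; rewrite inE => /orP[/eqP->|js]; rewrite scalerBr -linearZ.
    by rewrite fh ge subrr.
  by rewrite kh // linear0 subr0 ke.
- by rewrite linearB /= dc_diffK subr0.
Qed.

End Shifting.

(** * The action on E_x in coordinates *)

Lemma seq_argmax (T : eqType) (f : T -> nat) (s : seq T) :
  s != [::] -> exists2 x, x \in s & {in s, forall y, (f y <= f x)%N}.
Proof.
elim: s => // x s IH _; have [->|/IH[y ys hy]] := eqVneq s [::].
  by exists x; rewrite ?mem_head // => y; rewrite inE => /eqP->.
have [le_yx|lt_xy] := leqP (f y) (f x).
  exists x; rewrite ?mem_head // => z; rewrite inE => /predU1P[->//|/hy h].
  exact: leq_trans h le_yx.
exists y; first by rewrite inE ys orbT.
by move=> z; rewrite inE => /predU1P[->|/hy //]; apply: ltnW.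
Qed.

Section EModule.
Context {d : Order.disp_t} {P : simplicialPoset d} {K : fieldType} {x : P}.
Local Notation npstar := #|{: pstar P}|.
Local Notation polyS := {mpoly K[npstar]}.
Local Notation zdeg := {ffun vertex P -> int}.
Local Notation carrier := {freeg (mon x) / K}.
Implicit Types (k : mon x) (e : carrier) (z : pstar P) (w : inv_var x).

Lemma E_scaleX j (e : E_at K x) : 'X_j *: e = E_op (enum_val j) (e : carrier).
Proof.
rewrite -[LHS]/(op_scale (E_ops K x) 'X_j e) -['X_j]scale1r op_scaleZX scale1r.
rewrite /op_mnm; have := mem_enum 'I_npstar j; have := enum_uniq 'I_npstar.
have fold0 r : j \notin r ->
    foldr (fun i => iter (U_(j)%MM i) (E_ops K x i)) (e : carrier) r = e.
  elim: r => //= i r IH; rewrite inE => /norP[ji /IH ->].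
  by rewrite mnm1E (negPf ji).
elim: (enum _) => //= i r IH /andP[ir ur]; rewrite inE mnm1E.
by case: (eqVneq j i) ir => [<- jr|ji ir] /=; [rewrite fold0 | apply: IH].
Qed.

Lemma E_scaleC c (e : E_at K x) : c%:MP *: e = c *: (e : carrier).
Proof.
rewrite -[LHS]/(op_scale (E_ops K x) c%:MP e) -[c%:MP]mulr1 mul_mpolyC -mpolyX0.
by rewrite op_scaleZX op_mnm0.
Qed.

Lemma coeffE k e : coeff k e = \sum_(k' <- dom e) coeff k' e * (k' == k)%:R.
Proof.
by rewrite -{1}[e]freeg_sumE raddf_sum; apply: eq_bigr => k' _; rewrite /= coeffU.
Qed.

Lemma coeff_fglift (f : mon x -> carrier) e k :
  coeff k (fglift f e) = \sum_(k' <- dom e) coeff k' e * coeff k (f k').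
Proof.
rewrite -{1}[e]freeg_sumE !raddf_sum; apply: eq_bigr => k' _ /=.
by rewrite liftU coeffZ.
Qed.

(** K-linearity is automatic for the action of a polynomial, so it may be
    identified on monomials. *)
Lemma E_scale_ext p (h : {linear carrier -> carrier}) :
  (forall k, p *: (<< k >> : E_at K x) = h << k >>) ->
  forall e : E_at K x, p *: e = h (e : carrier).
Proof.
move=> ph e; rewrite -{1}[e : carrier]freeg_sumE -[e : carrier in RHS]freeg_sumE !linear_sum /=.
apply: eq_bigr => k _; rewrite freeg_scaleU linearZ /= -ph -!E_scaleC.
by rewrite !scalerA mulrC.
Qed.

(** Restriction of a degree to the Laurent exponents of [x]. *)
Definition res (a : zdeg) : {ffun lau_var x -> int} := [ffun i => a (val i)].
Definition incr (b : {ffun inv_var x -> nat}) w : {ffun inv_var x -> nat} :=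
  [ffun w' => (b w' + (w' == w))%N].
Definition mon0 : mon x := (0, [ffun=> 0%N]).
Definition inv_size k : nat := \sum_w k.2 w.

Lemma lau_actE z k : lau_act K z k =
  if (val z <= x)%O then << (k.1 + res (deg_t (val z)), k.2) >> else 0.
Proof.
rewrite /lau_act; case: ifP => // _; congr << (_ + _, _) >>.
by apply/ffunP => i; rewrite !ffunE.
Qed.

Lemma coeff_lau z e k : coeff k (fglift (lau_act K z) e) =
  if (val z <= x)%O then coeff (k.1 - res (deg_t (val z)), k.2) e else 0.
Proof.
rewrite coeff_fglift; have [zx|zx] := boolP (_ <= _)%O; last first.
  by rewrite big1 // => k' _; rewrite lau_actE (negPf zx) coeff0 mulr0.
rewrite [RHS]coeffE; apply: eq_bigr => k' _; rewrite lau_actE zx coeffU mul1r.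
by congr (_ * _%:R); case: k k' => a b [a' b'] /=; rewrite !xpair_eqE -subr_eq opprK.
Qed.

Lemma coeff_inv w e k : coeff k (fglift (inv_act K (val w)) e) =
  coeff (k.1, incr k.2 w) e.
Proof.
rewrite coeff_fglift [RHS]coeffE; apply: eq_bigr => k' _; congr (_ * _).
rewrite /inv_act valK; case: k k' => a b [a' b'] /=.
case: ifP => b'w; last first.
  rewrite coeff0 xpair_eqE; case: eqP => //= _; case: eqP => // b'E.
  by move: b'w; rewrite b'E ffunE eqxx addn1.
rewrite coeffU mul1r !xpair_eqE; congr ((_ && _)%:R).
apply/eqP/eqP => [<-|->]; apply/ffunP => v; rewrite !ffunE; last by rewrite addnK.
by case: eqP => [->|_]; rewrite ?subnK ?subn0 ?addn0.
Qed.

Lemma inv_act_vertex z e : ~~ [forall i in supp x, val i != val z] ->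
  fglift (inv_act K z) e = 0.
Proof.
move=> zi; apply/eqP/freeg_eqP => k; rewrite coeff_fglift coeff0 big1 // => k' _.
by rewrite /inv_act insubN // coeff0 mulr0.
Qed.

Lemma coeff_E_op_le z e k : (val z <= x)%O ->
  coeff k (E_op z e) = coeff (k.1 - res (deg_t (val z)), k.2) e +
    if insub z is Some w then coeff (k.1, incr k.2 w) e else 0.
Proof.
move=> zx; rewrite /E_op coeffD coeff_lau zx; congr (_ + _).
case: insubP => [w _ <-|zi]; first by rewrite coeff_inv.
by rewrite inv_act_vertex // coeff0.
Qed.

(** A variable below [x] acts as a unit, the Laurent part, plus an operator
    lowering [inv_size]: a monomial of maximal [inv_size] cannot cancel. *)
Lemma E_op_inj z e : (val z <= x)%O -> E_op z e = 0 -> e = 0.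
Proof.
move=> zx ze0; apply/eqP; rewrite -dom_eq0; apply/negP => /negP e0.
have [k ke kmax] := seq_argmax inv_size e0.
have := congr1 (coeff (k.1 + res (deg_t (val z)), k.2)) ze0.
rewrite coeff0 coeff_E_op_le //= addrK -surjective_pairing => /eqP.
rewrite addrC addr_eq0 => /eqP.
have ce : coeff k e != 0 by rewrite -mem_dom.
case: insubP => [w _ _|_]; last by move/eqP; rewrite eq_sym oppr_eq0 (negPf ce).
rewrite coeff_outdom => [/eqP|]; first by rewrite eq_sym oppr_eq0 (negPf ce).
apply/negP => /kmax; apply/negP; rewrite -ltnNge /inv_size /=.
rewrite (bigD1 w) //= [X in (_ < X)%N](bigD1 w) //= ffunE eqxx addn1 ltnS leq_add2l.
by apply: leq_sum => v _; rewrite ffunE leq_addr.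
Qed.

Lemma deg_mon_res k : res (deg_mon k) = k.1 + res (deg_inv k.2).
Proof. by apply/ffunP => i; rewrite !ffunE valK. Qed.

Lemma deg_mon_out k i : i \notin supp x -> deg_mon k i = deg_inv k.2 i.
Proof. by move=> ix; rewrite !ffunE insubN // add0r. Qed.

(** The Laurent exponents are determined by the degree and the inverse
    exponents. *)
Lemma deg_mon_inj k k' : deg_mon k = deg_mon k' -> k.2 = k'.2 -> k = k'.
Proof.
move=> dk k2; rewrite [k]surjective_pairing [k']surjective_pairing k2; congr (_, _).
by have := congr1 res dk; rewrite !deg_mon_res k2 => /addIr.
Qed.

Lemma deg_inv_incr b w : deg_inv (incr b w) = deg_inv b - deg_t (val (val w)).
Proof.
rewrite /deg_inv -opprD; congr (- _); rewrite (bigD1 w) //= [X in _ = X + _](bigD1 w) //=.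
rewrite ffunE eqxx addn1 mulrSr addrAC; congr (_ + _ + _).
by apply: eq_bigr => v /negPf vw; rewrite ffunE vw addn0.
Qed.

Lemma deg_mon_incr a b w : deg_mon (a, incr b w) = deg_mon (a, b) - deg_t (val (val w)).
Proof. by rewrite /deg_mon /= deg_inv_incr addrA. Qed.

Lemma deg_mon_res_add a (c : zdeg) b : (forall i, i \notin supp x -> c i = 0) ->
  deg_mon (a + res c, b) = deg_mon (a, b) + c.
Proof.
move=> hc; rewrite /deg_mon /= addrAC; congr (_ + _); apply/ffunP => i; rewrite !ffunE.
by case: insubP => [j _ <-|ix]; rewrite ?ffunE // add0r hc.
Qed.

Lemma deg_t_le_out z i : (val z <= x)%O -> i \notin supp x -> deg_t (val z) i = 0.
Proof.
move=> zx; rewrite inE ffunE inE; case: (boolP (val i <= val z)%O) => // iz.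
by rewrite (le_trans iz zx).
Qed.

Lemma deg_mon0 : deg_mon mon0 = 0.
Proof.
rewrite /deg_mon /deg_inv big1 => [|w _]; last by rewrite ffunE mulr0n.
by rewrite oppr0 addr0; apply/ffunP => i; rewrite !ffunE; case: insub => // j; rewrite ffunE.
Qed.

(** In the coordinates outside [supp x] only inverses contribute to the
    degree, and their contributions cannot cancel. *)
Lemma nonneg_deg_supp k w : nonneg_deg (deg_mon k) -> (0 < k.2 w)%N ->
  supp (val (val w)) \subset supp x.
Proof.
move=> /forallP k0 kw; apply/subsetP => i iw; apply: contraT => ix.
have := k0 i; rewrite deg_mon_out // ffunE oppr_ge0 sum_ffunE (bigD1 w) //=.
rewrite ffunMnE ffunE iw leNgt ltr_pwDl ?ltr0n //.
by rewrite sumr_ge0 // => v _; rewrite ffunMnE mulrn_wge0 // ffunE; case: (_ \in _).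
Qed.

(** Vertices of [x] are not inverse variables of E_x. *)
Lemma E_X_shift (m : 'X_{1..npstar}) k : (forall j, ~~ isvtx x j -> m j = 0%N) ->
  'X_[m] *: (<< k >> : E_at K x) = << (k.1 + res (deg_mnm m), k.2) >> :> carrier.
Proof.
move=> hm; rewrite mpolyXE_id /deg_mnm.
have res0 : res 0 = 0 by apply/ffunP => i; rewrite !ffunE.
have resD a b : res (a + b) = res a + res b by apply/ffunP => i; rewrite !ffunE.
have Xn j n l : isvtx x j ->
    'X_j ^+ n *: (<< l >> : E_at K x) =
    << (l.1 + res (deg_t (val (enum_val j)) *+ n), l.2) >> :> carrier.
  case/isvtxP => i ix jE; elim: n => [|n IH].
    by rewrite expr0 scale1r mulr0n res0 addr0 -surjective_pairing.
  have ij : (val (enum_val j) <= x)%O by rewrite jE val_vidx; rewrite inE in ix.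
  rewrite exprS -scalerA [X in _ *: X]IH E_scaleX E_op_U lau_actE ij /=.
  rewrite /inv_act insubN ?addr0 ?mulrSr ?resD ?addrA //.
  by apply/forall_inPn; exists i; rewrite // jE val_vidx eqxx.
elim: (index_enum _) k => [|j r IH] k.
  by rewrite !big_nil scale1r res0 addr0 -surjective_pairing.
rewrite !big_cons mulrC -scalerA; have [jx|jx] := boolP (isvtx x j).
  by rewrite [X in _ *: X]Xn // IH /= resD addrA.
by rewrite hm // expr0 scale1r IH mulr0n add0r.
Qed.
End EModule.

(** * Socles and the primes p_x *)

Section Socle.
Context {d : Order.disp_t} {P : simplicialPoset d} {K : fieldType}.
Local Notation npstar := #|{: pstar P}|.
Local Notation polyS := {mpoly K[npstar]}.

Definition one_at (x : P) : E_at K x := (<< mon0 >> : {freeg (mon x) / K}).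

Lemma one_at_homog (x : P) : homogeneous 0 (one_at x).
Proof. by move=> k; rewrite domU1 inE => /eqP->; apply: deg_mon0. Qed.

Definition supp_mnm (z : P) : 'X_{1..npstar} := (\sum_(i in supp z) U_(vidx i))%MM.

Lemma pi_x_mnm (x : P) j : (val (enum_val j) <= x)%O ->
  pi_x K x j = 'X_[supp_mnm (val (enum_val j))].
Proof.
move=> jx; rewrite /pi_x jx /supp_mnm.
by rewrite (big_morph (@mpolyX _ _) (@mpolyXD _ _) (@mpolyX0 _ _)).
Qed.

Lemma supp_mnm_out (x z : P) j : (z <= x)%O -> ~~ isvtx x j -> supp_mnm z j = 0%N.
Proof.
move=> zx jx; rewrite mnm_sumE big1 // => i iz; rewrite mnm1E; case: eqP => // ij.
by move: jx; rewrite -ij isvtx_vidx inE; rewrite inE in iz; rewrite (le_trans iz zx).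
Qed.

Lemma deg_supp_mnm (z : P) : deg_mnm (supp_mnm z) = deg_t z.
Proof.
rewrite [RHS]deg_t_sum_supp /supp_mnm.
rewrite (big_morph (@deg_mnm _ P) (@deg_mnmD _ P) (_ : deg_mnm 0%MM = 0)).
  by apply: eq_bigr => i _; rewrite deg_mnmU val_vidx.
by rewrite /deg_mnm big1 // => k _; rewrite mnm0E.
Qed.

(** On E_y with [y <= x] the lifts [pi_x] act through the Laurent factor
    only, so [rel_x] acts through the inverse system only. *)
Lemma pi_x_act (x y : P) j (e : E_at K y) : (val (enum_val j) <= y)%O -> (y <= x)%O ->
  pi_x K x j *: e = fglift (lau_act K (enum_val j)) (e : {freeg (mon y) / K}).
Proof.
move=> jy yx; rewrite pi_x_mnm ?(le_trans jy) //; apply: E_scale_ext => k /=.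
rewrite liftU scale1r lau_actE jy E_X_shift ?deg_supp_mnm // => i iy.
exact: supp_mnm_out iy.
Qed.

Lemma pi_x_out (x : P) j : ~~ (val (enum_val j) <= x)%O -> pi_x K x j = 0.
Proof. by rewrite /pi_x => /negPf->. Qed.

Lemma one_at_killed (x : P) j : rel_x K x j *: one_at x = 0.
Proof.
rewrite scalerBl E_scaleX; apply/eqP; rewrite subr_eq0; apply/eqP.
have inv0 : fglift (inv_act K (enum_val j)) (one_at x : {freeg (mon x) / K}) = 0.
  rewrite /one_at liftU scale1r /inv_act; case: insubP => // w _ _.
  by rewrite /= ffunE.
rewrite /E_op inv0 addr0; have [jx|jx] := boolP (val (enum_val j) <= x)%O.
  by rewrite pi_x_act.
by rewrite pi_x_out // scale0r /one_at liftU scale1r lau_actE (negPf jx).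
Qed.

(** In degree 0 only inverses of [w] with [supp w] inside [supp y] occur.  For
    such a [w] the relation of [x] acts as lowering the exponent of [w]; note
    that [w <= x] forces [w <= y] by [supp_sub_le].  So nothing but the
    monomial 1 survives. *)
Lemma killed_socle (x y : P) (e : E_at K y) : (y <= x)%O -> homogeneous 0 e ->
  killed x (nonvtx x) e ->
  e = coeff mon0 (e : {freeg (mon y) / K}) *: one_at y :> {freeg (mon y) / K}.
Proof.
move=> yx he ke; apply/eqP/freeg_eqP => k; rewrite coeffZ coeffU mul1r.
case: eqP => [<-|k0]; first by rewrite mulr1.
rewrite mulr0; apply: coeff_outdom; apply/negP => kd.
have dk : deg_mon k = 0 := he k kd.
have [w kw] : exists w, (0 < k.2 w)%N.
  apply/existsP; apply: contra_notT k0 => /existsPn k20.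
  apply: deg_mon_inj; rewrite ?dk ?deg_mon0 //=; apply/ffunP => w; rewrite ffunE.
  by have := k20 w; rewrite lt0n negbK => /eqP.
have wy : supp (val (val w)) \subset supp y.
  by apply: (nonneg_deg_supp _ kw); rewrite dk; apply/forallP => i; rewrite ffunE.
have inv0 : fglift (inv_act K (val w)) (e : {freeg (mon y) / K}) = 0.
  pose j := enum_rank (val w); have jE : enum_val j = val w by rewrite enum_rankK.
  have jx : ~~ isvtx x j.
    apply/negP => /isvtxP[i _ ji]; have wi : val (val w) = val i by rewrite -jE ji val_vidx.
    have iy : i \in supp y by apply: (subsetP wy); rewrite wi inE.
    by have /forall_inP/(_ i iy) := valP w; rewrite wi eqxx.
  have := ke j; rewrite mem_nonvtx => /(_ jx)/eqP.
  rewrite scalerBl subr_eq0 E_scaleX /E_op jE => /eqP.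
  have [wy'|wy'] := boolP (val (val w) <= y)%O.
    by rewrite pi_x_act ?jE // -[RHS]addr0 => /addrI.
  rewrite pi_x_out ?jE; last first.
    by apply: contra wy' => wx; apply: (supp_sub_le wx yx wy).
  rewrite scale0r => <-; rewrite -[LHS]add0r; congr (_ + _); symmetry.
  apply/eqP/freeg_eqP => k'; rewrite coeff_lau (negPf wy') coeff0 //.
have := coeff_inv w e (k.1, [ffun v => (k.2 v - (v == w))%N]); rewrite inv0 coeff0 /=.
suff -> : incr [ffun v => (k.2 v - (v == w))%N] w = k.2.
  by move/eqP; rewrite eq_sym -surjective_pairing -[_ == _]negbK -mem_dom kd.
apply/ffunP => v; rewrite !ffunE; case: eqP => [->|_]; first by rewrite subnK.
by rewrite subn0 addn0.
Qed.
End Socle.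
Arguments one_at {d P} K x.

Section Prime.
Context {d : Order.disp_t} {P : simplicialPoset d} {K : fieldType}.
Local Notation npstar := #|{: pstar P}|.
Local Notation polyS := {mpoly K[npstar]}.

Lemma rho_nonvtx_msupp (x : P) (p : polyS) m j :
  m \in msupp (rho K x (nonvtx x) p) -> ~~ isvtx x j -> m j = 0%N.
Proof.
move=> + jx; elim/mpoly_ring_ind: p m => [c|k|p q IHp IHq|p q IHp IHq] m.
- by rewrite rhoC msuppC; case: ifP => // _; rewrite inE => /eqP->; rewrite mnm0E.
- rewrite rhoX mem_nonvtx; case: ifPn => kx.
    have [kx'|kx'] := boolP (val (enum_val k) <= x)%O.
      by rewrite pi_x_mnm // msuppX inE => /eqP->; apply: supp_mnm_out jx.
    by rewrite pi_x_out // msupp0.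
  rewrite msuppX inE => /eqP->; rewrite mnm1E; case: eqP => // kj.
  by rewrite kj jx in kx.
- by rewrite rmorphD => /msuppD_le; rewrite mem_cat => /orP[/IHp|/IHq].
- rewrite rmorphM => /msuppM_le /allpairsP[[m1 m2] /= [/IHp h1 /IHq h2 ->]].
  by rewrite mnmDE h1 h2.
Qed.

Lemma deg_mnm_vidx (x : P) (m : 'X_{1..npstar}) i :
  (forall j, ~~ isvtx x j -> m j = 0%N) -> i \in supp x ->
  deg_mnm m i = (m (vidx i))%:R.
Proof.
move=> hm ix; rewrite sum_ffunE (bigD1 (vidx i)) //= big1 => [|j ji].
  by rewrite addr0 ffunMnE val_vidx deg_t_vertex eqxx.
rewrite ffunMnE; have [/isvtxP[i' _ jE]|/hm->] := boolP (isvtx x j); last by rewrite mulr0n.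
rewrite jE val_vidx deg_t_vertex; case: eqP => [e|_]; last by rewrite mul0rn.
by rewrite jE e eqxx in ji.
Qed.

(** Distinct monomials in the vertices of [x] send the monomial 1 of E_x to
    distinct monomials.  So the annihilator of 1 is the kernel of a ring
    morphism into a domain. *)
Lemma rho_faithful (x : P) (p : polyS) :
  p *: one_at K x = 0 -> rho K x (nonvtx x) p = 0.
Proof.
rewrite -(@rho_scale _ _ _ x (nonvtx x)); last by move=> j _; apply: one_at_killed.
move: (rho K x (nonvtx x) p) (@rho_nonvtx_msupp x p) => q hq q0.
apply/eqP; rewrite -msupp_eq0; apply/negP => /negP; case E: (msupp q) => [//|m r] _.
have mq : m \in msupp q by rewrite E mem_head.
have : coeff (res (deg_mnm m), [ffun=> 0%N]) (q *: one_at K x : {freeg (mon x) / K}) = 0.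
  by rewrite q0 coeff0.
rewrite -[q *: _]/(\sum_(m' <- msupp q) q@_m' *: op_mnm (E_ops K x) m' (one_at K x)).
rewrite raddf_sum (bigD1_seq m) //= big_seq_cond big1 => [|m' /andP[m'q m'm]].
  rewrite addr0 coeffZ -[op_mnm _ _ _]scale1r -op_scaleZX scale1r.
  rewrite -[op_scale _ _ _]/('X_[m] *: one_at K x) E_X_shift; last by move=> j; apply: hq.
  rewrite coeffU add0r eqxx !mulr1 => /eqP; apply/negP.
  by rewrite -mcoeff_msupp.
rewrite coeffZ -[op_mnm _ _ _]scale1r -op_scaleZX scale1r.
rewrite -[op_scale _ _ _]/('X_[m'] *: one_at K x) E_X_shift; last by move=> j; apply: hq.
rewrite coeffU add0r /= xpair_eqE; case: eqP => [e|_]; last by rewrite !mulr0.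
case/eqP: m'm; apply/mnmP => j.
have [/isvtxP[i ix ->]|jx] := boolP (isvtx x j); last by rewrite (hq m) // (hq m').
move/ffunP/(_ (Sub i ix)): e; rewrite !ffunE /= !(@deg_mnm_vidx x) //.
- by move/eqP; rewrite eqr_nat => /eqP.
- by move=> ?; apply: hq.
- by move=> ?; apply: hq.
Qed.

(** The variable of [y] is locally nilpotent on E_x and injective on E_y. *)
Lemma E_hom_out (x y : P) (psi : {linear E_at K x -> E_at K y}) :
  ~~ (y <= x)%O -> forall e, psi e = 0.
Proof.
move=> yx; have y0 : y != \bot%O by apply: contraNneq yx => ->; apply: le0x.
pose z : pstar P := Sub y y0.
have zi : [forall i in supp x, val i != val z].
  by apply/forall_inP => i; rewrite inE => ix; apply: contraNneq yx => /= <-.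
pose w : inv_var x := Sub z zi.
have psiU n : forall k : mon x, (k.2 w < n)%N -> psi (<< k >> : {freeg (mon x) / K}) = 0.
  elim: n => // n IH k kn; apply: (@E_op_inj _ _ _ _ z) => //.
  have zE : z = enum_val (enum_rank z) by rewrite enum_rankK.
  rewrite {1}zE -E_scaleX -linearZ E_scaleX -zE E_op_U lau_actE (negPf yx) add0r.
  rewrite /inv_act; case: insubP => [w' _ w'z|]; last by rewrite zi.
  have {w' w'z} -> : w' = w by apply: val_inj; rewrite w'z.
  case: ifP => kw; last by rewrite linear0.
  apply: IH; rewrite /= ffunE eqxx; move: kw kn; rewrite -/w.
  by case: (k.2 w) => // a _; rewrite subn1.
move=> e; rewrite -[e in psi e](@freeg_sumE K (mon x)) linear_sum big1 // => k _.
by rewrite freeg_scaleU -E_scaleC linearZ /= (psiU (k.2 w).+1) ?scaler0.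
Qed.
End Prime.

Section Differential.
Context {d : Order.disp_t} {P : simplicialPoset d} {K : fieldType}.
Context {D : dualizingComplex P K} (phi : forall i, identification D i).
Local Notation npstar := #|{: pstar P}|.
Local Notation polyS := {mpoly K[npstar]}.
Local Notation EM r := (fun x : rank_set P r => E_at K (rank_pt x)).

Lemma dsum_inj_linear r (x : rank_set P r) (p : polyS) (u v : E_at K (rank_pt x)) :
  dsum_inj (M := EM r) (p *: u + v) = p *: dsum_inj (M := EM r) u + dsum_inj (M := EM r) v.
Proof.
have scaleE (U V : dsum_type (EM r)) y : (p *: U + V) y = p *: U y + V y.
  by rewrite !ffunE.
apply/ffunP => y; rewrite scaleE; have [<-|xy] := eqVneq x y; first by rewrite !dsum_injE.
by rewrite !dsum_inj_neq // scaler0 addr0.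
Qed.

Definition gamma_inj r (x : rank_set P r) (e : E_at K (rank_pt x)) : E_rank P K r :=
  dsum_inj (M := EM r) e.
Definition gamma_proj r (x : rank_set P r) (e : E_rank P K r) : E_at K (rank_pt x) :=
  (e : dsum_type (EM r)) x.
HB.instance Definition _ r x := GRing.isLinear.Build polyS _ (E_rank P K r) *:%R
  (@gamma_inj r x) (@dsum_inj_linear r x).
Fact gamma_proj_linear r x : linear (@gamma_proj r x).
Proof. by move=> p u v; rewrite /gamma_proj !ffunE. Qed.
HB.instance Definition _ r x := GRing.isLinear.Build polyS (E_rank P K r) _ *:%R
  (@gamma_proj r x) (@gamma_proj_linear r x).

Lemma gamma_inj_homog r (x : rank_set P r) a (e : E_at K (rank_pt x)) :
  homogeneous a e -> homogeneous a (gamma_inj e).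
Proof.
move=> he y; rewrite /gamma_inj; have [<-|xy] := eqVneq x y; first by rewrite dsum_injE.
by rewrite dsum_inj_neq //; apply: homog0.
Qed.

Lemma gamma_proj_inj r (x : rank_set P r) (e : E_at K (rank_pt x)) :
  gamma_proj x (gamma_inj e) = e.
Proof. exact: (dsum_injE (M := EM r)). Qed.

Lemma gamma_proj_inj_neq r (x y : rank_set P r) (e : E_at K (rank_pt x)) :
  x != y -> gamma_proj y (gamma_inj e) = 0.
Proof. exact: (dsum_inj_neq (M := EM r)). Qed.

Lemma gamma_sum r (e : E_rank P K r) : e = \sum_x gamma_inj (gamma_proj x e).
Proof.
apply/ffunP => y; rewrite -[LHS]/(gamma_proj y e) -[RHS]/(gamma_proj y _) linear_sum.
rewrite (bigD1 y) //= gamma_proj_inj big1 ?addr0 // => x xy.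
by rewrite gamma_proj_inj_neq.
Qed.

(** That I_P lies in p_x is read off from the identification rather than from
    the face relations: E_x occurs in Gamma, so a power of I_P kills the
    monomial 1 of E_x, and p_x is prime. *)
Lemma face_ideal_killed r (x : rank_set P r) (M : gradedModule P K) (u : M) g :
  killed (rank_pt x) (nonvtx (rank_pt x)) u -> @face_ideal _ P K g -> g *: u = 0.
Proof.
move=> ku hg; have [k hk] : Gamma (phi r (gamma_inj (one_at K (rank_pt x)))).
  by apply/(id_image (phi r)); eexists.
suff rg : rho K (rank_pt x) (nonvtx (rank_pt x)) g = 0.
  by rewrite -(rho_scale ku) rg scale0r.
have gk : ideal_pow (@face_ideal _ P K) k (g ^+ k).
  exists [:: (1, g ^+ k)]; split; last by rewrite big_seq1 mul1r.
  move=> c; rewrite inE => /eqP->; exists (fun=> g); split=> //.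
  by rewrite prodr_const card_ord.
have /rho_faithful/eqP : g ^+ k *: one_at K (rank_pt x) = 0.
  have := hk _ gk; rewrite -!linearZ -[RHS](linear0 (phi r)) => /(@id_inj _ _ _ _ _ (phi r)).
  by move/(congr1 (gamma_proj x)); rewrite gamma_proj_inj linear0.
by rewrite rmorphXn expf_eq0 => /andP[_ /eqP].
Qed.

(** If the monomial 1 of E_x were a cocycle, [koszul_vanishing] would make it
    the boundary of some [e] killed by p_x.  Such an [e] lies in Gamma, in the
    sum of the E_y with [y] of larger rank than [x]; but there the variable of
    [y], which lies in p_x, acts injectively, so [e] vanishes. *)
Lemma gamma_diff_one_neq0 r (x : rank_set P r.+1) :
  gamma_diff phi r (gamma_inj (one_at K (rank_pt x))) <> 0.
Proof.
move=> d0; pose u := phi r.+1 (gamma_inj (one_at K (rank_pt x))).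
have rx : rank (rank_pt x) = r.+1 := eqP (valP x).
have hu : homogeneous 0 u by apply/ghomP/gamma_inj_homog/one_at_homog.
have ku : killed (rank_pt x) (nonvtx (rank_pt x)) u.
  by move=> j _; rewrite -!linearZ one_at_killed !linear0.
have zu : cocycle (dc_diff D) u.
  by rewrite /= /u -gamma_diffE -[gamma_diff_fun _ _]/(gamma_diff phi r _) d0 linear0.
have x0 : rank_pt x != \bot%O by rewrite -rank_eq0 rx.
have [||||e [he ke eu]] :=
  @koszul_vanishing _ _ _ _ D (nonvtx (rank_pt x)) _ _ r.+1 u 0 _ _ hu ku zu.
- by rewrite filter_uniq ?enum_uniq.
- by move=> j; rewrite mem_nonvtx.
- by have := size_nonvtx (rank_pt x); rewrite rx => ->.
- move=> _; have [i ix] := supp_neq0 x0; exists i.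
  by rewrite (deg_w_nonvtx (rank_pt x)) -deg_t_sum_supp add0r [ltRHS]ffunE ltrDr ffunE ix.
have /(id_image (phi r.+2))[e' e'E] : Gamma e.
  exists 1%N => p [s [hs ->]]; rewrite scaler_suml big_seq big1 // => c /hs[v [hv vE]].
  rewrite -scalerA vE big_ord1 (face_ideal_killed ke) // scaler0 //.
suff e'0 : e' = 0.
  move: eu; rewrite -e'E e'0 !linear0 => /esym u0.
  have /(@id_inj _ _ _ _ _ (phi r.+1)) : u = phi r.+1 0 by rewrite linear0.
  move/(congr1 (gamma_proj x)); rewrite gamma_proj_inj linear0.
  by move/(congr1 (coeff mon0)); rewrite coeffU eqxx mulr1 coeff0 => /eqP; rewrite oner_eq0.
apply/ffunP => y; rewrite ffunE.
have yx : ~~ (rank_pt y <= rank_pt x)%O.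
  apply/negP; rewrite le_eqVlt => /predU1P[yx|/rank_lt].
    by have := eqP (valP y); rewrite -[val y]/(rank_pt y) yx rx => /eqP; rewrite eqn_leq ltnn andbF.
  by rewrite rx (eqP (valP y)) ltnNge leqnSn.
have y0 : rank_pt y != \bot%O by rewrite -rank_eq0 (eqP (valP y)).
pose z : pstar P := Sub (rank_pt y) y0.
apply: (@E_op_inj _ _ _ _ z) => //.
have zE : z = enum_val (enum_rank z) by rewrite enum_rankK.
rewrite {1}zE -E_scaleX -[X in _ *: X]/(gamma_proj y e') -linearZ.
have := ke (enum_rank z); rewrite mem_nonvtx /isvtx -zE (negPf yx) andbF => /(_ isT).
rewrite /rel_x pi_x_out -?zE // subr0 -e'E -linearZ -(linear0 (phi r.+2)).
by move/(@id_inj _ _ _ _ _ (phi r.+2)) ->; rewrite linear0.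
Qed.
End Differential.

(** * Automorphisms given by power series *)

Section InverseAutomorphism.
Context {d : Order.disp_t} {P : simplicialPoset d} {K : fieldType}.
Context (M : gradedModule P K) (tau : ghom M M).
Context (tau_inj : injective tau) (tau_surj : forall u, exists v, tau v == u).

Definition inverse_fun (u : M) : M := xchoose (tau_surj u).

Fact inverse_funK u : tau (inverse_fun u) = u.
Proof. exact/eqP/(xchooseP (tau_surj u)). Qed.

Fact inverse_fun_linear : linear inverse_fun.
Proof. by move=> p u v; apply: tau_inj; rewrite linearP !inverse_funK. Qed.

HB.instance Definition _ := GRing.isLinear.Build _ M M *:%R inverse_fun
  inverse_fun_linear.

Fact inverse_fun_homog a u : homogeneous a u -> homogeneous a (inverse_fun u).
Proof. by move=> hu; apply: (ghom_inj_homog tau_inj); rewrite inverse_funK. Qed.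

Definition inverse_ghom : ghom M M := @GHom _ _ _ M M inverse_fun inverse_fun_homog.

Fact inverse_bij : bijective inverse_ghom.
Proof.
exists tau; first exact: inverse_funK.
by move=> u; apply: tau_inj; rewrite /= inverse_funK.
Qed.

Definition inverse_gaut : gaut M := GAut inverse_bij.
End InverseAutomorphism.

Section PowerSeries.
Context {d : Order.disp_t} {P : simplicialPoset d} {K : fieldType} (x : P).
Local Notation npstar := #|{: pstar P}|.
Local Notation polyS := {mpoly K[npstar]}.
Local Notation zdeg := {ffun vertex P -> int}.
Local Notation carrier := {freeg (mon x) / K}.
Local Notation expo := {ffun inv_var x -> nat}.
Context (lam : carrier -> K).
Implicit Types (k : mon x) (b : expo).

(** The value of [lam] at the monomial of degree 0 with inverse exponents
    [b].  If [b] involves vertices outside [x] there is no such monomial, and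
    the value is never used. *)
Definition series_coeff b : K := lam << (res (- deg_inv b), b) >>.
Definition expo_sub b b' : expo := [ffun w => (b w - b' w)%N].
Definition expo_le b b' : bool := [forall w, (b w <= b' w)%N].
Definition retarget k b : mon x := (k.1 + res (deg_inv k.2 - deg_inv b), b).

(** The action of the power series with coefficients [series_coeff b] on the
    monomial [k], where the [b]-th power of the variables s_z lowers the
    inverse exponents by [b] and keeps the degree; the test on degrees discards
    the [b] for which this is impossible.  The sum runs over the remaining
    inverse exponents, which are bounded by [inv_size k]. *)
Definition series_mon k : carrier :=
  \sum_(c : {ffun inv_var x -> 'I_(inv_size k).+1})
    (let b : expo := [ffun w => c w : nat] in
     if expo_le b k.2 && (deg_mon (retarget k b) == deg_mon k)
     then << series_coeff (expo_sub k.2 b) *g retarget k b >> else 0).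

Lemma resB (a b : zdeg) : res (x := x) (a - b) = res a - res b.
Proof. by apply/ffunP => i; rewrite !ffunE. Qed.

Lemma retargetE k k' : deg_mon k' = deg_mon k -> retarget k k'.2 = k'.
Proof.
move/(congr1 (res (x := x))); rewrite !deg_mon_res => e.
by rewrite /retarget resB addrA -e addrK -surjective_pairing.
Qed.

Lemma coeff_series_mon k k' : coeff k' (series_mon k) =
  if expo_le k'.2 k.2 && (deg_mon k' == deg_mon k)
  then series_coeff (expo_sub k.2 k'.2) else 0.
Proof.
rewrite raddf_sum /=; case: ifPn => [/andP[le_k /eqP dk]|nk].
  pose c0 : {ffun inv_var x -> 'I_(inv_size k).+1} := [ffun w => inord (k'.2 w)].
  have c0E : [ffun w => c0 w : nat] = k'.2 :> expo.
    apply/ffunP => w; rewrite !ffunE inordK // ltnS.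
    apply: leq_trans (forallP le_k w) _.
    by rewrite /inv_size (bigD1 w) //= leq_addr.
  rewrite (bigD1 c0) //= c0E le_k retargetE // dk eqxx coeffU eqxx mulr1.
  rewrite big1 ?addr0 // => c cc0; case: ifP => _; last exact: coeff0.
  rewrite coeffU; case: eqP => [/(congr1 snd) /= e|_]; last by rewrite mulr0.
  case/eqP: cc0; apply/ffunP => w; apply: val_inj.
  have := congr1 (fun b : expo => b w) e; have := congr1 (fun b : expo => b w) c0E.
  by rewrite !ffunE /= => -> ->.
rewrite big1 // => c _; case: ifP => [/andP[cl cd]|_]; last exact: coeff0.
rewrite coeffU; case: eqP => [e|_]; last by rewrite mulr0.
by case/negP: nk; rewrite -e cl cd.
Qed.

Definition series (e : E_at K x) : E_at K x := fglift series_mon (e : carrier).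

Lemma seriesU k : series (<< k >> : carrier) = series_mon k.
Proof. by rewrite /series liftU scale1r. Qed.

Lemma series_lau z k :
  fglift series_mon (lau_act K z k) = fglift (lau_act K z) (series_mon k).
Proof.
rewrite lau_actE; apply/eqP/freeg_eqP => k'; rewrite coeff_lau.
case: ifP => zx; last by rewrite linear0 coeff0.
rewrite liftU scale1r !coeff_series_mon /=.
have out i : i \notin supp x -> deg_t (val z) i = 0 by apply: deg_t_le_out.
rewrite deg_mon_res_add // -surjective_pairing.
have -> : deg_mon (k'.1 - res (deg_t (val z)), k'.2) = deg_mon k' - deg_t (val z).
  apply: (addIr (deg_t (val z))); rewrite -deg_mon_res_add //.
  by rewrite !subrK -surjective_pairing.
by rewrite -(subr_eq (deg_mon k')). 
Qed.

Lemma series_inv z k :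
  fglift series_mon (inv_act K z k) = fglift (inv_act K z) (series_mon k).
Proof.
have [zi|zi] := boolP [forall i in supp x, val i != val z]; last first.
  by rewrite inv_act_vertex // /inv_act insubN // linear0.
have [w <-] : exists w : inv_var x, val w = z by exists (Sub z zi).
apply/eqP/freeg_eqP => k'; rewrite coeff_inv coeff_series_mon /= /inv_act valK.
rewrite deg_mon_incr -surjective_pairing.
have le_incr b b' : expo_le (incr b w) b' =
    (0 < b' w)%N && expo_le b [ffun v => (b' v - (v == w))%N].
  apply/forallP/andP => [h|[b'0 /forallP h] v].
    have := h w; rewrite ffunE eqxx addn1 => bw; split; first exact: leq_trans bw.
    by apply/forallP => v; have := h v; rewrite !ffunE; case: (v == w); lia.
  have := h v; rewrite !ffunE; case: eqP => [->|_]; lia.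
rewrite le_incr; case: ifP => k0; last by rewrite linear0 coeff0.
rewrite liftU scale1r coeff_series_mon /=.
have incrK : incr [ffun v => (k.2 v - (v == w))%N] w = k.2.
  by apply/ffunP => v; rewrite !ffunE; case: eqP => [->|_]; rewrite ?subnK ?subn0 ?addn0.
have -> : deg_mon (k.1, [ffun v => (k.2 v - (v == w))%N]) = deg_mon k + deg_t (val (val w)).
  apply/eqP; rewrite -subr_eq -deg_mon_incr incrK.
  by rewrite -surjective_pairing.
rewrite -(subr_eq (deg_mon k')); congr (if _ then series_coeff _ else _).
by apply/ffunP => v; rewrite !ffunE -subnDA addnC.
Qed.

Lemma series_scale p (e : E_at K x) : series (p *: e) = p *: series e.
Proof.
apply: scale_additive_linear p e => [u v|c u|j u].
- exact: (linearD (fglift series_mon)).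
- by rewrite !E_scaleC /series linearZ.
- rewrite !E_scaleX /series.
  rewrite -[u : carrier]freeg_sumE !linear_sum; apply: eq_bigr => k _.
  rewrite freeg_scaleU !linearZ /=; congr (_ *: _).
  by rewrite E_op_U linearD /= series_lau series_inv liftU scale1r.
Qed.

Fact series_linear : linear series.
Proof.
move=> p u v; rewrite -series_scale; exact: (linearD (fglift series_mon)).
Qed.
HB.instance Definition _ := GRing.isLinear.Build polyS (E_at K x) (E_at K x) *:%R
  series series_linear.

Fact series_homog a (e : E_at K x) : homogeneous a e -> homogeneous a (series e).
Proof.
move=> he k'; rewrite mem_dom coeff_fglift; apply: contra_neq_eq => ka.
rewrite big_seq big1 // => k kd; rewrite coeff_series_mon (he k kd) (negPf ka).
by rewrite andbF mulr0.
Qed.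

Definition series_ghom : ghom (E_at K x) (E_at K x) :=
  @GHom _ _ _ (E_at K x) (E_at K x) series series_homog.

Lemma expo_le_size k k' : expo_le k'.2 k.2 -> deg_mon k' = deg_mon k ->
  k' != k -> (inv_size k' < inv_size k)%N.
Proof.
move=> /forallP le_k dk; apply: contra_neqT; rewrite -leqNgt => ge_k.
apply: (deg_mon_inj dk); apply/ffunP => w; apply/eqP; rewrite eqn_leq le_k /=.
rewrite leqNgt; apply/negP => lt_w; move: ge_k; apply/negP; rewrite -ltnNge.
rewrite /inv_size (bigD1 w) //= [X in (_ < X)%N](bigD1 w) //= -addSn.
by apply: leq_add => //; apply: leq_sum.
Qed.

Lemma series_coeff0 b : series_coeff (expo_sub b b) = lam << mon0 >>.
Proof.
rewrite /series_coeff; congr (lam << (_, _) >>).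
  apply/ffunP => i; rewrite !ffunE /deg_inv big1 ?oppr0 ?ffunE // => w _.
  by rewrite ffunE subnn mulr0n.
by apply/ffunP => w; rewrite !ffunE subnn.
Qed.

Lemma coeff_series_mon_diag k : coeff k (series_mon k) = lam << mon0 >>.
Proof.
rewrite coeff_series_mon eqxx andbT series_coeff0 ifT //.
by apply/forallP.
Qed.

Context (lam1 : lam << mon0 >> != 0).

(** The series is unitriangular with respect to [inv_size], with [lam] of the
    monomial 1 on the diagonal. *)
Lemma series_inj : injective series.
Proof.
suff inj0 e : series e = 0 -> e = 0.
  by move=> u v uv; apply/eqP; rewrite -subr_eq0; apply/eqP/inj0; rewrite linearB /= uv subrr.
move=> e0; apply/eqP; rewrite -[_ == _]/(e == 0 :> carrier) -dom_eq0.
apply/negP => /negP /(seq_argmax (@inv_size _ _ _))[k kd kmax].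
have := congr1 (coeff k) (e0 : series e = 0 :> carrier).
rewrite coeff0 coeff_fglift (bigD1_seq k) ?uniq_dom //= big1_seq => [|k' /andP[k'k k'd]].
  rewrite addr0 coeff_series_mon_diag => /eqP; rewrite mulf_eq0 (negPf lam1) orbF.
  by apply/negP; rewrite -mem_dom.
rewrite coeff_series_mon; case: ifP => [/andP[le_k /eqP dk]|_]; last by rewrite mulr0.
have := kmax k' k'd; rewrite leqNgt (expo_le_size le_k dk) //.
by rewrite eq_sym.
Qed.

Lemma series_surj (u : E_at K x) : exists e, series e == u.
Proof.
have span (e : carrier) : {in dom e, forall k, exists e', series e' = << k >> :> carrier} ->
    exists e', series e' = e :> carrier.
  move=> he; rewrite -[e]freeg_sumE big_seq.
  elim/big_rec: _ => [|k f kd [f' fE]]; first by exists 0; rewrite linear0.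
  have [e' eE] := he k kd; exists ((coeff k e)%:MP *: e' + f').
  by rewrite linearD linearZ /= fE freeg_scaleU eE E_scaleC.
have surjU n k : (inv_size k < n)%N -> exists e', series e' = << k >> :> carrier.
  elim: n k => // n IH k kn.
  have [e' eE] : exists e', series e' = series_mon k - lam << mon0 >> *: << k >> :> carrier.
    apply: span => k'; rewrite mem_dom coeffB coeffZ coeffU mul1r.
    have [<-|kk] := eqVneq k k'; first by rewrite coeff_series_mon_diag mulr1 subrr eqxx.
    rewrite mulr0 subr0 coeff_series_mon.
    case: ifP => [/andP[le_k /eqP dk] _|]; last by rewrite eqxx.
    apply: IH; rewrite ltnS in kn; apply: leq_trans kn; apply: expo_le_size => //.
    by rewrite eq_sym.
  exists ((lam << mon0 >>)^-1%:MP *: ((<< k >> : carrier) - e' : E_at K x)).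
  rewrite linearZ linearB /= E_scaleC seriesU eE opprB addrC subrK.
  by rewrite scalerA mulVf // scale1r.
have [e eE] := span u (fun k _ => surjU _ k (ltnSn _)).
by exists e; apply/eqP.
Qed.

(** With this basis of E_x, the coefficient of the monomial 1 of an element of
    degree 0 becomes its value under [lam]. *)
Definition straightening : gaut (E_at K x) :=
  @inverse_gaut _ _ _ _ series_ghom series_inj series_surj.

Lemma straighteningK e : series (straightening e) = e.
Proof. exact: (@inverse_funK _ _ _ _ series_ghom). Qed.

(** A monomial of degree 0 contributes to the coefficient of 1 only through
    the term that removes all its inverse variables. *)
Lemma coeff_series (e : E_at K x) :
  (forall c u v, lam (c *: u + v) = c * lam u + lam v) -> homogeneous 0 e ->
  coeff mon0 (series e : carrier) = lam e.
Proof.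
move=> lamP he; have lam0 : lam 0 = 0.
  have := lamP 1 0 0; rewrite scale1r mul1r addr0 => e0.
  by apply: (addrI (lam 0)); rewrite addr0 -e0.
rewrite /series coeff_fglift -[e in RHS]freeg_sumE.
rewrite big_seq [in RHS]big_seq; elim/big_rec2: _ => [|k u v kd ->] //.
rewrite freeg_scaleU lamP; congr (_ * _ + _); rewrite coeff_series_mon.
have dk : deg_mon k = 0 := he k kd.
rewrite dk deg_mon0 eqxx andbT ifT; last by apply/forallP => w; rewrite ffunE.
have -> : expo_sub k.2 mon0.2 = k.2 by apply/ffunP => w; rewrite !ffunE subn0.
rewrite /series_coeff [k in RHS]surjective_pairing; congr (lam << (_, _) >>).
have := congr1 (res (x := x)) dk; rewrite deg_mon_res => dk1.
apply: (addIr (res (deg_inv k.2))); rewrite dk1.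
by apply/ffunP => i; rewrite !ffunE addNr.
Qed.
End PowerSeries.

(** * Components of the differential *)

Section Components.
Context {d : Order.disp_t} {P : simplicialPoset d} {K : fieldType}.
Context {D : dualizingComplex P K} (phi : forall i, identification D i).
Local Notation polyS := {mpoly K[#|{: pstar P}|]}.

Definition gcomp r (x : rank_set P r.+1) (y : rank_set P r)
    (e : E_at K (rank_pt x)) : E_at K (rank_pt y) :=
  gamma_proj y (gamma_diff phi r (gamma_inj e)).

Fact gcomp_linear r x y : linear (@gcomp r x y).
Proof. by move=> p u v; rewrite /gcomp !linearP. Qed.
HB.instance Definition _ r x y := GRing.isLinear.Build polyS _ _ *:%R
  (@gcomp r x y) (@gcomp_linear r x y).

Lemma gcomp_homog r x y a e : homogeneous a e -> homogeneous a (@gcomp r x y e).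
Proof. by move=> he; apply: (ghomP (gamma_diff phi r) (gamma_inj_homog he)). Qed.

Lemma gcomp_out r x y e : ~~ (rank_pt y <= rank_pt x)%O -> @gcomp r x y e = 0.
Proof. by move=> yx; apply: (E_hom_out (@gcomp r x y)). Qed.

Lemma gamma_diff_comp r (e : E_rank P K r.+1) y :
  gamma_proj y (gamma_diff phi r e) = \sum_x gcomp y (gamma_proj x e).
Proof. by rewrite {1}(gamma_sum e) !linear_sum. Qed.

Lemma gamma_diffK r (e : E_rank P K r.+2) :
  gamma_diff phi r (gamma_diff phi r.+1 e) = 0.
Proof.
apply: (@id_inj _ _ _ _ _ (phi r)).
by rewrite /= gamma_diffE gamma_diffE dc_diffK linear0.
Qed.

(** By [rank_diamond] all other summands of d o d from [x] to [w] vanish. *)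
Lemma gcomp_diamond r (x : rank_set P r.+2) (y1 y2 : rank_set P r.+1) :
  y1 != y2 -> (rank_pt y1 <= rank_pt x)%O -> (rank_pt y2 <= rank_pt x)%O ->
  exists w : rank_set P r, [/\ (rank_pt w <= rank_pt y1)%O, (rank_pt w <= rank_pt y2)%O &
    forall e, gcomp w (gcomp (x := x) y1 e) + gcomp w (gcomp (x := x) y2 e) = 0].
Proof.
have rE n (z : rank_set P n) : rank (rank_pt z) = n := eqP (valP z).
move=> y12 y1x y2x.
have [||w [rw wy1 wy2 wP]] := @rank_diamond _ _ (rank_pt x) _ _ y12 y1x y2x; rewrite ?rE //.
have {}rw : rank w == r by rewrite rE in rw; case: rw => ->.
exists (Sub w rw : rank_set P r); split=> // e.
have := gamma_diff_comp (gamma_diff phi r.+1 (gamma_inj e)) (Sub w rw).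
rewrite gamma_diffK linear0 (bigD1 y1) //= (bigD1 y2) 1?eq_sym //= big1 ?addr0 //.
move=> y /andP[yy1 yy2].
have [yx|yx] := boolP (rank_pt y <= rank_pt x)%O; last first.
  by rewrite -/(gcomp y e) (gcomp_out e yx) linear0.
have [wy|wy] := boolP (w <= rank_pt y)%O; last by rewrite gcomp_out.
have [|/val_inj e1|/val_inj e2] := wP _ wy yx; rewrite ?rE //.
- by rewrite e1 eqxx in yy1.
- by rewrite e2 eqxx in yy2.
Qed.

Definition cov_coeff r (x : rank_set P r.+1) (y : rank_set P r) : K :=
  coeff mon0 (gcomp (x := x) y (one_at K _) : {freeg (mon (rank_pt y)) / K}).

(** The image of the monomial 1 is killed by p_x, hence in the socle. *)
Lemma gcomp_one r (x : rank_set P r.+1) (y : rank_set P r) :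
  gcomp (x := x) y (one_at K _) = (cov_coeff x y)%:MP *: one_at K _.
Proof.
rewrite /cov_coeff; have [yx|yx] := boolP (rank_pt y <= rank_pt x)%O.
  rewrite {1}(@killed_socle _ _ _ (rank_pt x) _ (gcomp y (one_at K (rank_pt x)))) ?E_scaleC //.
    by apply: gcomp_homog; apply: one_at_homog.
  by move=> j _; rewrite -linearZ one_at_killed linear0.
by rewrite gcomp_out // coeff0 mpolyC0 scale0r.
Qed.

Lemma gcomp_one_neq0 r (x : rank_set P r.+1) :
  exists2 y : rank_set P r, (rank_pt y <= rank_pt x)%O & cov_coeff x y != 0.
Proof.
suff /existsP[y cy] : [exists y : rank_set P r, cov_coeff x y != 0].
  exists y => //; apply: contraNT cy => yx.
  by rewrite /cov_coeff gcomp_out // coeff0.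
apply: contra_notT (@gamma_diff_one_neq0 _ _ _ _ phi r x) => /existsPn h.
rewrite [LHS]gamma_sum big1 // => y _; rewrite -[gamma_proj _ _]/(gcomp y _) gcomp_one.
by have := h y; rewrite negbK => /eqP->; rewrite mpolyC0 scale0r linear0.
Qed.

(** Some [y1] below [x] has a nonzero coefficient; the relation through a
    common [w] below [y] and [y1] transports this to [y]. *)
Lemma cov_coeff_neq0 r (x : rank_set P r.+1) (y : rank_set P r) :
  (rank_pt y <= rank_pt x)%O -> cov_coeff x y != 0.
Proof.
elim: r x y => [|r IH] x y yx; have [y1 y1x c1] := gcomp_one_neq0 x.
  have bot (z : rank_set P 0) : val z = \bot%O by apply/eqP; rewrite -rank_eq0 (valP z).
  suff -> : y = y1 by [].
  by apply: val_inj; rewrite !bot.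
have [->//|yy1] := eqVneq y y1.
have [w [wy wy1 /(_ (one_at K _))]] := gcomp_diamond yy1 yx y1x.
rewrite !gcomp_one !linearZ /= !gcomp_one => h; apply: contraTneq (IH _ _ wy1) => c0.
move: h; rewrite c0 mpolyC0 scale0r add0r scalerA -mpolyCM E_scaleC.
move/(congr1 (coeff mon0)); rewrite coeffZ coeffU eqxx !mulr1 coeff0 => /eqP.
by rewrite mulf_eq0 (negPf c1) /= => /eqP->; rewrite eqxx.
Qed.

(** The forms lambda_x of the introduction, without normalization. *)
Fixpoint socle_form r : forall x : rank_set P r, E_at K (rank_pt x) -> K :=
  match r with
  | 0 => fun x e => coeff mon0 (e : {freeg (mon (rank_pt x)) / K})
  | r'.+1 => fun x e =>
      if [pick y : rank_set P r' | (rank_pt y <= rank_pt x)%O] is Some y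
      then socle_form (gcomp y e) else 0
  end.

Lemma socle_form_linear r (x : rank_set P r) c u v :
  socle_form (c%:MP *: u + v : E_at K (rank_pt x)) = c * socle_form u + socle_form v.
Proof.
elim: r x u v => [|r IH] x u v /=; first by rewrite E_scaleC coeffD coeffZ.
by case: pickP => [y _|_]; rewrite ?linearP ?IH // mulr0 addr0.
Qed.

Lemma socle_form_scale r (x : rank_set P r) c u :
  socle_form (c%:MP *: u : E_at K (rank_pt x)) = c * socle_form u.
Proof.
have l0 : socle_form (0 : E_at K (rank_pt x)) = 0.
  have := socle_form_linear 1 (0 : E_at K (rank_pt x)) 0; rewrite scaler0 addr0 mul1r => e0.
  by apply: (addrI (socle_form (0 : E_at K (rank_pt x)))); rewrite addr0 -e0.
by rewrite -[_ *: u]addr0 socle_form_linear l0 addr0.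
Qed.

Lemma socle_form_one_neq0 r (x : rank_set P r) : socle_form (one_at K (rank_pt x)) != 0.
Proof.
elim: r x => [|r IH] x /=; first by rewrite coeffU eqxx mulr1 oner_eq0.
case: pickP => [y yx|noy]; last first.
  by have [y yx _] := gcomp_one_neq0 x; rewrite noy in yx.
by rewrite gcomp_one socle_form_scale mulf_neq0 ?cov_coeff_neq0.
Qed.

(** For [y] other than the element [y0] that defines the form at [x], apply
    the form of [w] to the relation through [w]; by induction it is a multiple,
    nonzero in view of the monomial 1, of the form at [y] after d_yw. *)
Lemma socle_form_gcomp r (x : rank_set P r.+1) (y : rank_set P r) :
  exists c, forall e, socle_form (gcomp (x := x) y e) = c * socle_form e.
Proof.
have [yx|yx] := boolP (rank_pt y <= rank_pt x)%O; last first.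
  by exists 0 => e; rewrite gcomp_out // mul0r -[0](scale0r 0) -mpolyC0 socle_form_scale mul0r.
elim: r x y yx => [|r IH] x y yx.
  exists 1 => e; rewrite mul1r /=; case: pickP => [y0 y0x|/(_ y)]; last by rewrite yx.
  have bot (z : rank_set P 0) : val z = \bot%O by apply/eqP; rewrite -rank_eq0 (valP z).
  by have -> : y = y0 by apply: val_inj; rewrite !bot.
pose y0' := [pick y : rank_set P r.+1 | (rank_pt y <= rank_pt x)%O].
case E: y0' => [y0|]; last by move: E; rewrite /y0'; case: pickP => // /(_ y); rewrite yx.
have formE e : socle_form (e : E_at K (rank_pt x)) = socle_form (gcomp y0 e).
  by rewrite [LHS]/= -/y0' E.
have y0x : (rank_pt y0 <= rank_pt x)%O by move: E; rewrite /y0'; case: pickP => // ? ? [<-].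
have [->|yy0] := eqVneq y y0; first by exists 1 => e; rewrite mul1r formE.
have [w [wy wy0 h]] := gcomp_diamond yy0 yx y0x.
have [c cP] := IH y w wy; have [c0 c0P] := IH y0 w wy0.
have c_neq0 : c != 0.
  have := cP (one_at K _); rewrite gcomp_one socle_form_scale; apply: contra_eq_neq => ->.
  by rewrite mul0r mulf_neq0 ?cov_coeff_neq0 ?socle_form_one_neq0.
exists (- c^-1 * c0) => e; rewrite formE; apply: (mulfI c_neq0).
rewrite !mulNr mulrN -mulrA mulVKf //.
have := congr1 (@socle_form _ _) (h e).
rewrite -[X in socle_form (X + _)]scale1r -mpolyC1 socle_form_linear.
rewrite mul1r cP c0P => /eqP; rewrite -[0](scale0r (0 : E_at K _)) -mpolyC0 socle_form_scale mul0r.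
by rewrite addr_eq0 => /eqP->.
Qed.
End Components.

(** * Clean bases *)

Section CalL.
Context {d : Order.disp_t} {P : simplicialPoset d} {K : fieldType} {x : P}.

(** Every element of P^* lies above a vertex, so inverting it makes the total
    degree negative. *)
Lemma calL_mon (k : mon x) :
  (exists2 i : nat, (1 <= i)%N & total_deg (deg_inv k.2) = - i%:Z) <->
  k.2 != [ffun=> 0%N].
Proof.
pose n := (\sum_i \sum_(w : inv_var x) (i \in supp (val (val w))) * k.2 w)%N.
have degE : total_deg (deg_inv k.2) = - n%:Z.
  have degi i : deg_inv k.2 i =
      - ((\sum_(w : inv_var x) (i \in supp (val (val w))) * k.2 w)%N : int).
    rewrite ffunE sum_ffunE -natz natr_sum; congr (- _); apply: eq_bigr => w _.
    by rewrite ffunMnE ffunE -mulrnA.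
  rewrite /total_deg (eq_bigr _ (fun i _ => degi i)) sumrN; congr (- _).
  by rewrite /n -natz natr_sum; apply: eq_bigr => i _; rewrite natz.
split=> [[i i1]|k0].
  rewrite degE => /oppr_inj [nE]; apply: contraTneq i1 => k0.
  rewrite -nE /n big1 // => j _; rewrite big1 // => w _.
  by rewrite k0 ffunE muln0.
exists n => //; rewrite lt0n; apply: contra_neq k0 => /eqP.
rewrite sum_nat_eq0 => /forallP n0; apply/ffunP => w; rewrite ffunE.
have [i iw] := supp_neq0 (valP (val w)).
have := n0 i; rewrite implyTb sum_nat_eq0 => /forallP/(_ w).
by rewrite iw mul1n implyTb => /eqP.
Qed.

Lemma calL_add (u v : E_at K x) : calL u -> calL v -> calL (u + v).
Proof. by move=> hu hv k /domD_subset; rewrite mem_cat => /orP[/hu|/hv]. Qed.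

Lemma calL_scale c (u : E_at K x) : calL u -> calL (c%:MP *: u).
Proof. by move=> hu k; rewrite E_scaleC => /domZ_subset /hu. Qed.

Definition mon_at (k : mon x) : E_at K x := (<< k >> : {freeg (mon x) / K}).

Lemma E_at_monomial_ind (Q : E_at K x -> Prop) (e : E_at K x) : Q 0 ->
  (forall c k u, k \in dom (e : {freeg (mon x) / K}) -> Q u ->
     Q (c%:MP *: mon_at k + u)) -> Q e.
Proof.
move=> Q0 QD; rewrite -[e](@freeg_sumE K (mon x)) big_seq.
elim/big_rec: _ => [|k u ke Qu]; first exact: Q0.
by rewrite freeg_scaleU -E_scaleC; apply: QD.
Qed.

Lemma calL0 : calL (0 : E_at K x).
Proof. by move=> k; rewrite dom0. Qed.

Lemma exists_deg_mnm (a : {ffun vertex P -> int}) :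
  nonneg_deg a -> (forall i, i \notin supp x -> a i = 0) ->
  exists2 m, deg_mnm m = a & forall j, ~~ isvtx x j -> m j = 0%N.
Proof.
move=> /forallP a0 ax.
exists (\sum_(i in supp x) U_(vidx i) *+ `|a i|)%MM; last first.
  move=> j jx; rewrite mnm_sumE big1 // => i ix; rewrite mulmnE mnm1E.
  by case: eqP => // ij; rewrite -ij isvtx_vidx ix in jx.
have mul m n : deg_mnm (m *+ n : 'X_{1..#|{: pstar P}|})%MM = deg_mnm m *+ n.
  rewrite /deg_mnm -sumrMnl; apply: eq_bigr => j _.
  by rewrite mulmnE mulrnA.
rewrite (big_morph (@deg_mnm _ P) (@deg_mnmD _ P) (_ : deg_mnm 0%MM = 0)); last first.
  by rewrite /deg_mnm big1 // => j _; rewrite mnm0E.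
apply/ffunP => i; rewrite sum_ffunE.
under eq_bigr do rewrite mul deg_mnmU val_vidx ffunMnE deg_t_vertex.
have [ix|ix] := boolP (i \in supp x); last first.
  rewrite ax // big1 // => j jx; case: eqP => [e|_]; last exact: mul0rn.
  by rewrite -e jx in ix.
rewrite (bigD1 i) //= eqxx big1 ?addr0 => [|j /andP[_ /negPf->]]; last exact: mul0rn.
by rewrite -mulrnA mul1n natz gez0_abs.
Qed.
End CalL.

Section Bases.
Context {d : Order.disp_t} {P : simplicialPoset d} {K : fieldType}.
Context {D : dualizingComplex P K} (phi : forall i, identification D i).

Definition rank_of (x : P) : rank_set P (rank x) := Sub x (eqxx (rank x)).

Definition socle_form_at (x : P) (e : E_at K x) : K := socle_form phi (x := rank_of x) e.

(** The rank of [rank_pt x] equals [r] only propositionally. *)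
Lemma socle_form_atE r (x : rank_set P r) e :
  socle_form_at (x := rank_pt x) e = socle_form phi (x := x) e.
Proof.
case: x e => x rx e; have rE := eqP rx; subst r.
by rewrite /socle_form_at /rank_of (bool_irrelevance (eqxx (rank x)) rx).
Qed.

Lemma socle_form_at_one x : socle_form_at (<< mon0 >> : {freeg (mon x) / K}) != 0.
Proof. exact: (socle_form_one_neq0 phi (rank_of x)). Qed.

Definition clean_bases : bases P K := fun x => straightening (socle_form_at_one x).

Lemma socle_form_clean_bases x (e : E_at K x) : homogeneous 0 e ->
  socle_form_at (clean_bases x e) = coeff mon0 (e : {freeg (mon x) / K}).
Proof.
move=> he; rewrite -(@coeff_series _ _ _ _ (@socle_form_at x)).
- by rewrite straighteningK.
- by move=> c u v; rewrite -E_scaleC; apply: (socle_form_linear phi (x := rank_of x)).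
- exact: ghomP.
Qed.

Lemma clean_bases_surj x (u : E_at K x) : exists v, clean_bases x v = u.
Proof. by have [g _ gK] := gaut_bij (clean_bases x); exists (g u). Qed.

Lemma clean_bases_inj x : injective (clean_bases x).
Proof. exact/bij_inj/gaut_bij. Qed.

(** Suppose that the image of [k] involves a monomial without inverse
    variables.  Then its degree, that of [k], is supported on [supp y], so a
    monomial in the vertices of [y] shifts everything to degree 0.  There the
    coefficient of 1 is the form at [y] of the image, a multiple of the
    coefficient of 1 in the shifted [k], which is zero. *)
Lemma clean_component_mon r (x : rank_set P r.+1) (y : rank_set P r) (k : mon (rank_pt x)) :
  k.2 != [ffun=> 0%N] -> nonneg_deg (deg_mon k) ->
  exists2 f, calL f & clean_bases (rank_pt y) f =
    gcomp phi y (clean_bases (rank_pt x) (<< k >> : {freeg (mon (rank_pt x)) / K})).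
Proof.
move=> k0 ak; have [yx|yx] := boolP (rank_pt y <= rank_pt x)%O; last first.
  by exists 0; [exact: calL0 | rewrite gcomp_out // linear0].
pose e : E_at K (rank_pt x) := << k >>.
have [f fE] := clean_bases_surj (gcomp phi y (clean_bases _ e)).
exists f => // k' k'f.
have he : homogeneous (deg_mon k) e by move=> l; rewrite domU1 inE => /eqP->.
have dk' : deg_mon k' = deg_mon k.
  have : homogeneous (deg_mon k) f.
    by apply: (ghom_inj_homog (@clean_bases_inj _)); rewrite fE; apply/gcomp_homog/ghomP.
  by move/(_ k'); apply.
split; last by rewrite dk'.
apply/calL_mon; apply: contraTneq k'f => k'0.
have out i : i \notin supp (rank_pt y) -> deg_mon k i = 0.
  move=> iy; rewrite -dk' deg_mon_out // k'0 /deg_inv big1 ?oppr0 ?ffunE // => w _.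
  by rewrite ffunE mulr0n.
have [m mE my] := exists_deg_mnm ak out.
have mx j : ~~ isvtx (rank_pt x) j -> m j = 0%N.
  move=> jx; apply: my; apply: contra jx => /andP[r1 jy].
  by rewrite /isvtx r1 (le_trans jy yx).
pose k1 : mon (rank_pt x) := (k.1 - res (deg_mnm m), k.2).
pose e1 : E_at K (rank_pt x) := << k1 >>.
have eE : e = 'X_[m] *: e1.
  by rewrite E_X_shift //= subrK -surjective_pairing.
have dk1 : deg_mon k1 = 0.
  apply: (addIr (deg_mnm m)); rewrite -deg_mon_res_add => [|i ix].
    by rewrite subrK -surjective_pairing add0r mE.
  rewrite mE out //; apply: contra ix; rewrite !inE => /le_trans; exact.
have he1 : homogeneous 0 e1 by move=> l; rewrite domU1 inE => /eqP->.
have [f1 f1E] := clean_bases_surj (gcomp phi y (clean_bases _ e1)).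
have hf1 : homogeneous 0 f1.
  by apply: (ghom_inj_homog (@clean_bases_inj _)); rewrite f1E; apply/gcomp_homog/ghomP.
have fX : f = 'X_[m] *: f1.
  by apply: clean_bases_inj; rewrite linearZ /= f1E fE eE !linearZ.
have f10 : coeff mon0 (f1 : {freeg (mon (rank_pt y)) / K}) = 0.
  rewrite -socle_form_clean_bases // f1E socle_form_atE; have [c ->] := socle_form_gcomp phi x y.
  rewrite -socle_form_atE socle_form_clean_bases // coeffU.
  case: eqP => [e0|_]; last by rewrite !mulr0.
  by have := congr1 snd e0; rewrite /= => k20; rewrite k20 eqxx in k0.
pose shiftm (l : mon (rank_pt y)) : {freeg (mon (rank_pt y)) / K} :=
  << (l.1 + res (deg_mnm m), l.2) >>.
have XE (g : E_at K (rank_pt y)) : 'X_[m] *: g = fglift shiftm (g : {freeg _ / K}).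
  by apply: (@E_scale_ext _ _ _ _ _ (fglift shiftm)) => l /=; rewrite E_X_shift // liftU scale1r.
rewrite mem_dom negbK fX XE coeff_fglift big_seq big1 // => l lf1; rewrite coeffU mul1r.
case: eqP => [lk|_]; last by rewrite mulr0.
suff -> : l = mon0 by rewrite f10 mul0r.
apply: deg_mon_inj; first by rewrite deg_mon0; apply: hf1.
by rewrite -[l.2]/((l.1 + res (deg_mnm m), l.2).2) lk.
Qed.

Lemma clean_component r (x : rank_set P r.+1) (y : rank_set P r) (e : E_at K (rank_pt x)) :
  calL e -> exists2 f, calL f & clean_bases (rank_pt y) f =
    gcomp phi y (clean_bases (rank_pt x) e).
Proof.
move=> he; apply: (@E_at_monomial_ind _ _ _ _ (fun u => exists2 f, calL f &
  clean_bases (rank_pt y) f = gcomp phi y (clean_bases (rank_pt x) u)) e).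
  by exists 0; [exact: calL0 | rewrite !linear0].
move=> c k u ke [f hf fE]; have [/calL_mon k0 ak] := he k ke.
have [g hg gE] := clean_component_mon y k0 ak.
exists (c%:MP *: g + f); first by apply: calL_add hf; apply: calL_scale.
by rewrite !linearP gE fE.
Qed.
End Bases.

Theorem theorem4p5 (d : Order.disp_t) (P : simplicialPoset d) (K : fieldType)
    (D : dualizingComplex P K) (phi : forall i, identification D i) :
  exists sigma : bases P K, forall i : nat, clean sigma (gamma_diff phi i).
Proof.
exists (clean_bases phi) => r e he y.
have -> : (gamma_diff phi r e : dsum_type _) y =
    \sum_x gcomp phi y (gamma_proj x e) by exact: gamma_diff_comp.
elim/big_rec: _ => [|x u _ [f hf fE]]; first by exists 0; [exact: calL0 | rewrite linear0].
have [e' he' eE] := he x; have [g hg gE] := clean_component phi y he'.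
exists (g + f); first exact: calL_add.
by rewrite linearD fE gE eE.
Qed.
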